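(* Let $h$ be a real-valued function continuous on $[0,\infty)$ and thrice differentiable on $(0,\infty)$ such that $h(0)=0$, $h(t)\to\infty$ as $t\to\infty$, and for all $t>0$: $h'(t)>0$, $h''(t)<0$, $h'''(t)>0$. Let $Q\subset\mathbb{R}$ be an interval and assume that $\varphi$ is a non-constant, integrable function on $Q$ that satisfies $K_{h,Q}(\varphi)<\infty$. Then $\varphi\in\mathrm{BMO}(Q)$ and for any subinterval $J$ of $Q$ $$ \frac{\langle\varphi^2\rangle_J-\langle\varphi\rangle_J^2}{4\|\varphi\|^2_{\mathrm{BMO}(Q)}}\,h\big(2\|\varphi\|_{\mathrm{BMO}(Q)}\big)\le \langle h(|\varphi-\langle\varphi\rangle_J|)\rangle_J . $$ This inequality is sharp, in the sense that there exist a non-constant, integrable function $\varphi$ on $Q$ with $K_{h,Q}(\varphi)<\infty$ and a subinterval $J$ of $Q$ on which $\varphi$ is non-constant for which it becomes an equality. Consequently, for every non-constant, integrable function $\varphi$ on $Q$ with $K_{h,Q}(\varphi)<\infty$, $$ h^{-1}\big(K_{h,Q}(\varphi)\big)\le\|\varphi\|_{\mathrm{BMO}(Q)}\le\tfrac12\,h^{-1}\big(4K_{h,Q}(\varphi)\big), $$ where $h^{-1}$ is the inverse function to $h$ on $[0,\infty)$.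
   Context: Intervals are bounded with positive length; functions are real-valued; ''non-constant'' means not almost everywhere equal to a constant. $\langle\varphi\rangle_J=\frac1{|J|}\int_J\varphi$. For a non-negative function $h$ on $[0,\infty)$ and $\varphi$ integrable on $Q$, $$K_{h,Q}(\varphi)=\sup_{J}\ \langle h(|\varphi-\langle\varphi\rangle_J|)\rangle_J,$$ the supremum over all subintervals $J$ of $Q$. The norm is $$\|\varphi\|_{\mathrm{BMO}(Q)}=\sup_{J}\big(\langle|\varphi-\langle\varphi\rangle_J|^2\rangle_J\big)^{1/2}=\sup_J\big(\langle\varphi^2\rangle_J-\langle\varphi\rangle_J^2\big)^{1/2},$$ the supremum over all subintervals $J$ of $Q$, and $\varphi\in\mathrm{BMO}(Q)$ means $\varphi\in L^1(Q)$ and $\|\varphi\|_{\mathrm{BMO}(Q)}<\infty$. *)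

(* Defs.v *)
From HB Require Import structures.
From mathcomp Require Import all_boot all_order all_algebra.
From mathcomp Require Import all_classical all_reals all_analysis.

Set Implicit Arguments.
Unset Strict Implicit.
Unset Printing Implicit Defensive.

Import Order.TTheory GRing.Theory Num.Theory.
Import numFieldNormedType.Exports.

Local Open Scope ring_scope.
Local Open Scope classical_set_scope.

(* An interval is bounded and of positive length; each endpoint may or may not
   belong to it, as decided by the booleans p and q. *)
Definition bounded_itv (R : realType) (J : set R) : Prop :=
  exists (p q : bool) (a b : R),
    a < b /\ J = [set` Interval (BSide p a) (BSide q b)].

Definition subinterval (R : realType) (J Q : set R) : Prop :=
  bounded_itv J /\ J `<=` Q.

(* Averages, integrability and "almost everywhere" all use the completed
   Lebesgue measure, so that functions are Lebesgue measurable and not merely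
   Borel measurable. *)

(* The average of f over J, as an extended real: it is +oo when f >= 0 is
   measurable and not integrable on J. *)
Definition eavg (R : realType) (J : set R) (f : R -> R) : \bar R :=
  ((@completed_lebesgue_measure R J)^-1 *
    \int[@completed_lebesgue_measure R]_(x in J) (f x)%:E)%E.

(* Equal to the average only when the latter is finite. *)
Definition avg (R : realType) (J : set R) (f : R -> R) : R := fine (eavg J f).

Definition integrable_on (R : realType) (Q : set R) (phi : R -> R) : Prop :=
  (@completed_lebesgue_measure R).-integrable Q (fun x => (phi x)%:E).

Definition nonconstant_on (R : realType) (Q : set R) (phi : R -> R) : Prop :=
  ~ exists c : R,
    {ae @completed_lebesgue_measure R, forall x, Q x -> phi x = c}.

Definition oscK (R : realType) (h : R -> R) (Q : set R) (phi : R -> R) :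
    \bar R :=
  ereal_sup [set eavg J (fun x => h `|phi x - avg J phi|) |
    J in [set J | subinterval J Q]].

Definition bmo_norm (R : realType) (Q : set R) (phi : R -> R) : \bar R :=
  ereal_sup [set sqrte (eavg J (fun x => `|phi x - avg J phi| ^+ 2)) |
    J in [set J | subinterval J Q]].

Definition BMO (R : realType) (Q : set R) (phi : R -> R) : Prop :=
  integrable_on Q phi /\ (bmo_norm Q phi < +oo)%E.

(* The inverse of h on [0, +oo) at every point of the image of [0, +oo),
   provided that h is injective on [0, +oo). *)
Definition inv_ge0 (R : realType) (h : R -> R) : R -> R :=
  pinv (`[0, +oo[ : set R) h.

(* Main.v *)
(* Write x1 = <f>_J and x2 = <f^2>_J, so that the point (x1, x2) of an interval J
   lies in the strip x1^2 <= x2 <= x1^2 + e^2 as soon as the BMO norm of f is at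
   most e. Let d > e and c = h(2d) / (4 d^2). Since h''' > 0, the function
   h(t) / t is convex; its tangent at t = 2d yields a polynomial
   L(t) = (h(2d) / 2d) t + k t (t - 2d) with k <= 0 and L(t) <= h(|t|) for all
   real t. Averaging L(f) and L(-f) gives <h(|f|)>_J >= c x2 whenever
   x2 <= 2d |x1|, that is, below the chords from (0, 0) to (+-2d, 4d^2), which
   touch the parabola x2 = x1^2 + d^2 at (+-d, 2d^2). An interval whose point lies
   above the chords with |x1| <= d is split in two: because e < d, the splitting
   point can be chosen, with controlled proportions, so that each half either
   lies below a chord or again has |x1| <= d. Almost every point that is never
   reached by a discarded interval satisfies f = 0 by Lebesgue differentiation,
   whence <h(|f|)>_J >= c x2. When |x1| > d, a cruder parabola below h suffices,
   and in all cases <h(|f - r|)>_J >= c (x2 - x1^2) for every constant r. Letting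
   d tend to the norm of f proves the inequality.

   The freedom in r also gives f in BMO: it applies to the truncations of f with
   r a truncated mean, as truncation contracts distances, and bounds their norms
   in terms of K. *)
Require Import Defs.
From HB Require Import structures.
From mathcomp Require Import all_boot all_order all_algebra.
From mathcomp Require Import all_classical all_reals all_analysis.
From mathcomp Require Import measurable_realfun ring lra.

Set Implicit Arguments.
Unset Strict Implicit.
Unset Printing Implicit Defensive.

Import Order.TTheory GRing.Theory Num.Theory.
Import numFieldNormedType.Exports.

Local Open Scope ring_scope.
Local Open Scope classical_set_scope.

Local Notation leb := (@lebesgue_measure _).
Local Notation clm := (@completed_lebesgue_measure _).
Local Notation loc_int := (locally_integrable [set: _]).

(** * Splitting an interval along a tangent line *)

(** The comparison function [c x2] is linear in the point of an interval, so splitting loses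
    nothing; the difficulty is to choose the split. A midpoint may leave a half with [|x1| > d]
    above the chord, which can be neither discarded nor split again. Up to reflection [x1 > d]. Let
    this half grow to the whole interval: its point moves continuously to that of the parent, inside
    the strip of height [e^2], which misses the tangency point [(d, 2 d^2)]. So it crosses the line
    from the parent's point through [(d, 2 d^2)] at an abscissa at least [d], where this line has
    passed under the chord; the sibling lies on the same line, on the other side of the parent. The
    gap between [e] and [d] keeps both proportions away from 1. The lower estimate of the norm by
    [K] has another source: it is concavity, through the tangent of [h] at the norm. All this is
    done for Borel functions, to which the fundamental theorem of calculus applies; a Lebesgue
    measurable function is first replaced by a Borel one with the same averages. *)

Lemma sqr_gap (R : realFieldType) (d e x1 x2 : R) : 0 < e -> e < d ->
  2 * d * `|x1| < x2 -> x2 <= x1 ^+ 2 + e ^+ 2 ->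
  d ^+ 2 - e ^+ 2 < (d - x1) ^+ 2.
Proof.
move=> e0 ed x_chord x_strip.
have : d * x1 <= d * `|x1| by rewrite ler_pM2l ?ler_norm//; apply: lt_trans ed.
by lra.
Qed.

(** Over [|x1| = d] the strip only reaches [d^2 + e^2], strictly below the tangency points at height
    [2 d^2], so no point above the chords lies there. *)
Lemma tangent_point_lt (R : realFieldType) (d e x1 x2 : R) : 0 < e -> e < d ->
  `|x1| <= d -> 2 * d * `|x1| < x2 -> x2 <= x1 ^+ 2 + e ^+ 2 ->
  `|x1| < d /\ x2 < 2 * d ^+ 2.
Proof.
move=> e0 ed x1d x_chord x_strip.
have x1sq : x1 ^+ 2 = `|x1| ^+ 2 by rewrite real_normK ?num_real.
have x10 : 0 <= `|x1| by [].
have x1d' : `|x1| < d.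
  by rewrite lt_neqAle x1d andbT; apply/eqP => E;
    rewrite x1sq E in x_strip x_chord; nra.
by rewrite x1sq in x_strip; split => //; nra.
Qed.

(** Along the line through [(x1, x2)] and [(d, 2 d^2)] the height above the chord [2 d y1] is
    affine; it is positive at [x1] and zero at [d], hence nonpositive from [d] on. *)
Lemma tangent_near (R : realFieldType) (d x1 x2 y1 y2 : R) :
  `|x1| < d -> 2 * d * `|x1| < x2 -> d <= y1 ->
  (y2 - x2) * (d - x1) = (2 * d ^+ 2 - x2) * (y1 - x1) ->
  y2 <= 2 * d * `|y1|.
Proof.
move=> x1d x_chord dy yE.
have x10 : 0 <= `|x1| by [].
have y10 : 0 <= y1 by lra.
have x1le := ler_norm x1.
rewrite ger0_norm// -subr_le0 -(@pmulr_lle0 _ (d - x1)); last lra.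
have -> : (y2 - 2 * d * y1) * (d - x1) = (2 * d * x1 - x2) * (y1 - d).
  have -> : (y2 - 2 * d * y1) * (d - x1) =
    (y2 - x2) * (d - x1) + (x2 - 2 * d * y1) * (d - x1) by ring.
  by rewrite yE; ring.
apply: mulr_le0_ge0; last lra.
have : d * x1 <= d * `|x1| by apply: ler_wpM2l => //; lra.
by lra.
Qed.

(** The line rises towards [(d, 2 d^2)], so left of [-d] it is below [2 d^2], whereas the left chord
    is above [2 d^2] there. *)
Lemma tangent_far (R : realFieldType) (d x1 x2 z1 z2 : R) :
  `|x1| < d -> x2 < 2 * d ^+ 2 -> z1 <= d ->
  (z2 - x2) * (d - x1) = (2 * d ^+ 2 - x2) * (z1 - x1) ->
  `|z1| <= d \/ z2 <= 2 * d * `|z1|.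
Proof.
move=> x1d' x2d zd zE.
have x10 : 0 <= `|x1| by [].
have x1le := ler_norm x1; have x1ge := ler_norm (- x1); rewrite normrN in x1ge.
have [dz|zd'] := leP (- d) z1; first by left; rewrite ler_norml dz.
right; rewrite ltr0_norm; last lra.
rewrite -subr_le0 -(@pmulr_lle0 _ (d - x1)); last lra.
have -> : (z2 - 2 * d * - z1) * (d - x1) =
    (4 * d ^+ 2 - x2 - 2 * d * x1) * (z1 + d) + 2 * d * (x2 - 2 * d ^+ 2).
  have -> : (z2 - 2 * d * - z1) * (d - x1) =
    (z2 - x2) * (d - x1) + (x2 + 2 * d * z1) * (d - x1) by ring.
  by rewrite zE; ring.
have : (4 * d ^+ 2 - x2 - 2 * d * x1) * (z1 + d) <= 0.
  apply: mulr_ge0_le0; last lra.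
  have : d * x1 <= d * d by apply: ler_wpM2l; lra.
  by lra.
have : 2 * d * (x2 - 2 * d ^+ 2) <= 0 by apply: mulr_ge0_le0; lra.
by lra.
Qed.

(** [f] tells on which side of the line through the tangency point the child lies. A zero of [f]
    alone could have abscissa below [d]; the minimum with [g] excludes this. If the zero of the
    minimum came from [g], the child would have abscissa [d] and height at most [d^2 + e^2 < 2 d^2],
    which makes [f] negative. *)
Lemma tangent_crossing (R : realType) (d e x1 x2 : R) (y1 y2 : R -> R) :
  0 < e -> e < d -> `|x1| < d -> y1 1 = x1 ->
  (forall r, 2^-1 <= r <= 1 ->
    {for r, continuous y1} /\ {for r, continuous y2}) ->
  (forall r, 2^-1 <= r <= 1 -> y2 r <= y1 r ^+ 2 + e ^+ 2) ->
  2 * d * `|x1| < x2 -> d < y1 2^-1 -> 2 * d * y1 2^-1 < y2 2^-1 ->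
  exists r, [/\ 2^-1 <= r, r < 1, d <= y1 r &
    (y2 r - x2) * (d - x1) = (2 * d ^+ 2 - x2) * (y1 r - x1)].
Proof.
move=> e0 ed x1d y1E cy ys xc dy dy2; have x1le := ler_norm x1.
pose f r := (y2 r - x2) * (d - x1) - (2 * d ^+ 2 - x2) * (y1 r - x1).
pose g r := y1 r - d.
have le_half : 2^-1 <= 1 :> R by lra.
have cf r : 2^-1 <= r <= 1 -> {for r, continuous (g \min f)}.
  move=> /cy[c1 c2]; apply: (@continuous_min R R g f).
    by apply: cvgB => //; apply: cvg_cst.
  apply: cvgB; first by apply: cvgM; [apply: cvgB => //|]; apply: cvg_cst.
  by apply: cvgM; [|apply: cvgB => //]; apply: cvg_cst.
have [||r] := @IVT R (g \min f) 2^-1 1 0 le_half.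
- apply: continuous_in_subspaceT => r; rewrite inE /= in_itv /=; exact: cf.
- have g1 : Num.min (g 1) (f 1) < 0.
    by rewrite gt_min; apply/orP; left; rewrite /g y1E; lra.
  have gh : 0 < Num.min (g 2^-1) (f 2^-1).
    rewrite lt_min; apply/andP; split; first by rewrite /g; lra.
    have -> : f 2^-1 = (y2 2^-1 - 2 * d * y1 2^-1) * (d - x1) +
       (x2 - 2 * d * x1) * (y1 2^-1 - d) by rewrite /f; ring.
    have dx : d * x1 <= d * `|x1| by apply: ler_wpM2l => //; lra.
    by apply: addr_gt0; apply: mulr_gt0; lra.
  apply/andP; split; first by apply: le_trans (ltW g1); rewrite ge_min lexx orbT.
  by apply: le_trans (ltW gh) _; rewrite le_max lexx.
rewrite in_itv /= => rI /= gf; have /andP[r0 r1] := rI.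
have dd : (d - e) * (d + e) > 0 by apply: mulr_gt0; lra.
have [fE gE] : f r = 0 /\ 0 <= g r.
  move: gf; rewrite minElt; case: ltP => [gf ge|fg fe]; last by rewrite -fe.
  have yE : y1 r = d by rewrite /g in ge; lra.
  have : f r < 0.
    have -> : f r = (y2 r - 2 * d ^+ 2) * (d - x1) by rewrite /f yE; ring.
    rewrite nmulr_rlt0; first lra.
    by have := ys r rI; rewrite yE; lra.
  by lra.
exists r; split => //; last by move: fE; rewrite /f; lra.
  rewrite lt_neqAle r1 andbT; apply/eqP => rE.
  by move: gE; rewrite /g rE y1E; lra.
by move: gE; rewrite /g; lra.
Qed.

(* x is the point (<f>, <f^2>) of an interval, y r the point of a child of relative
   length r at one fixed end of it, and z r the point of the other child. *)
Lemma tangent_split (R : realType) (d e x1 x2 : R) (y1 y2 z1 z2 : R -> R) :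
  0 < e -> e < d -> `|x1| <= d -> 2 * d * `|x1| < x2 ->
  x2 <= x1 ^+ 2 + e ^+ 2 -> y1 1 = x1 ->
  (forall r, 2^-1 <= r <= 1 ->
    {for r, continuous y1} /\ {for r, continuous y2}) ->
  (forall r, 2^-1 <= r <= 1 -> y1 r ^+ 2 <= y2 r <= y1 r ^+ 2 + e ^+ 2) ->
  (forall r, 2^-1 <= r < 1 -> [/\ r * y1 r + (1 - r) * z1 r = x1,
     r * y2 r + (1 - r) * z2 r = x2 & z1 r ^+ 2 <= z2 r]) ->
  d < `|y1 2^-1| -> 2 * d * `|y1 2^-1| < y2 2^-1 ->
  exists r, [/\ 2^-1 <= r, r * d ^+ 2 <= e ^+ 2,
    `|y1 r| <= d \/ y2 r <= 2 * d * `|y1 r| &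
    `|z1 r| <= d \/ z2 r <= 2 * d * `|z1 r| ].
Proof.
wlog y1h : x1 y1 z1 / 0 <= y1 2^-1.
  move=> wlg; have [|yneg] := leP 0 (y1 2^-1); first exact: wlg.
  move=> e0 ed x1d xc xs y1E cy ys zE yd yd2.
  have [||||||||||r] := wlg (- x1) (- y1) (- z1) _ e0 ed; rewrite /= ?normrN ?sqrrN //=.
  - by rewrite oppr_ge0 ltW.
  - by rewrite -y1E.
  - by move=> r /cy[c1 c2]; split => //; apply: continuousN.
  - by move=> r /ys; rewrite sqrrN.
  - move=> r /zE[<- <- z3]; split => //; rewrite /= ?sqrrN //.
    by rewrite -[LHS]/(r * - y1 r + (1 - r) * - z1 r); ring.
  by rewrite ?normrN => H; exists r.
move=> e0 ed x1d xc xs y1E cy ys zE; rewrite (ger0_norm y1h) => yd yd2.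
have [x1d' x2d] := tangent_point_lt e0 ed x1d xc xs.
have x1le := ler_norm x1.
have [] := @tangent_crossing R d e x1 x2 y1 y2 => //.
  by move=> r /ys/andP[].
move=> r [r0 r1 yr yline]; exists r.
have /zE[z1E z2E zsq] : 2^-1 <= r < 1 by rewrite r0.
have /ys/andP[ysq yst] : 2^-1 <= r <= 1 by rewrite r0 ltW.
have r'0 : 0 < 1 - r by lra.
have e1 : (1 - r) * (z1 r - x1) = - r * (y1 r - x1).
  by rewrite -[in LHS]z1E -[in RHS]z1E; ring.
have zline : (z2 r - x2) * (d - x1) = (2 * d ^+ 2 - x2) * (z1 r - x1).
  apply: (mulfI (lt0r_neq0 r'0)).
  have e2 : (1 - r) * (z2 r - x2) = - r * (y2 r - x2)
    by rewrite -[in LHS]z2E -[in RHS]z2E; ring.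
  rewrite mulrA e2 -mulrA yline.
  have -> : (1 - r) * ((2 * d ^+ 2 - x2) * (z1 r - x1)) =
    (2 * d ^+ 2 - x2) * ((1 - r) * (z1 r - x1)) by ring.
  by rewrite e1; ring.
split => //.
(* The variance of the parent is at least the variance between the two children, which is
   [r (y1 - x1)^2 / (1 - r)]. By [sqr_gap] and [d <= y1 r], [(y1 - x1)^2] exceeds [d^2 - e^2], and
   this bounds [r]. *)
- have : r * (1 - r) * (y1 r - z1 r) ^+ 2 <= e ^+ 2.
    have : x2 - x1 ^+ 2 <= e ^+ 2 by lra.
    rewrite -z1E -z2E.
    have -> : r * y2 r + (1 - r) * z2 r - (r * y1 r + (1 - r) * z1 r) ^+ 2 =
      r * (y2 r - y1 r ^+ 2) + (1 - r) * (z2 r - z1 r ^+ 2) +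
      r * (1 - r) * (y1 r - z1 r) ^+ 2 by ring.
    have : 0 <= r * (y2 r - y1 r ^+ 2) by apply: mulr_ge0; lra.
    have : 0 <= (1 - r) * (z2 r - z1 r ^+ 2) by apply: mulr_ge0; lra.
    by lra.
  have -> : y1 r - z1 r = (y1 r - x1) / (1 - r).
    by apply: (mulIf (lt0r_neq0 r'0)); rewrite divfK ?lt0r_neq0// -z1E; ring.
  rewrite expr_div_n; have -> : r * (1 - r) * ((y1 r - x1) ^+ 2 / (1 - r) ^+ 2) =
    r * (y1 r - x1) ^+ 2 / (1 - r) by field; lra.
  rewrite ler_pdivrMr// => yx.
  have gap : d ^+ 2 - e ^+ 2 < (d - x1) ^+ 2 by apply: sqr_gap xc xs.
  have : (d - x1) ^+ 2 <= (y1 r - x1) ^+ 2 by rewrite ler_sqr ?nnegrE; lra.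
  have rge0 : 0 <= r by lra.
  by move=> /(ler_wpM2l rge0); have := ler_wpM2l rge0 (ltW gap); lra.
- by right; apply: tangent_near yline.
- apply: tangent_far zline => //.
  have : (1 - r) * (z1 r - x1) <= 0.
    by rewrite e1 mulNr oppr_le0; apply: mulr_ge0; lra.
  by rewrite pmulr_rle0//; lra.
Qed.

(** For a primitive [F] this is the mean over [[s, t]], so the splitting and stopping arguments can
    be carried out without integrals. *)
Definition slope (R : realType) (F : R -> R) (s t : R) : R :=
  (F t - F s) / (t - s).

Lemma slope_mid (R : realType) (F : R -> R) (s m t : R) : s < m -> m < t ->
  (m - s) * slope F s m + (t - m) * slope F m t = (t - s) * slope F s t.
Proof. by move=> sm mt; rewrite /slope; field; lra. Qed.

Lemma continuous_slope_l (R : realType) (F : R -> R) (s l r : R) :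
  r != 0 -> l != 0 -> {for s + r * l, continuous F} ->
  {for r, continuous (fun r : R => slope F s (s + r * l))}.
Proof.
move=> r0 l0 cF; rewrite /slope.
have caff : {for r, continuous (fun r : R => s + r * l)}.
  by apply: cvgD; [exact: cvg_cst|apply: cvgM; [exact: cvg_id|exact: cvg_cst]].
apply: cvgM; first by apply: cvgB; [exact: (@continuous_comp R R R _ F r caff
  cF)|exact: cvg_cst].
apply: cvgV; first by rewrite addrC addKr mulf_neq0.
by apply: cvgB => //; exact: cvg_cst.
Qed.

Lemma continuous_slope_r (R : realType) (F : R -> R) (t l r : R) :
  r != 0 -> l != 0 -> {for t - r * l, continuous F} ->
  {for r, continuous (fun r : R => slope F (t - r * l) t)}.
Proof.
move=> r0 l0 cF; rewrite /slope.
have caff : {for r, continuous (fun r : R => t - r * l)}.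
  by apply: cvgB; [exact: cvg_cst|apply: cvgM; [exact: cvg_id|exact: cvg_cst]].
apply: cvgM; first by apply: cvgB; [exact: cvg_cst|exact: (@continuous_comp R R R _
  F r caff cF)].
apply: cvgV; first by rewrite subKr mulf_neq0.
by apply: cvgB => //; exact: cvg_cst.
Qed.

(** The midpoint serves unless one half lies above the chord with [|x1| > d]; that half is then
    enlarged, its outer end fixed, as in [tangent_split]. The larger child has proportion at most
    [e^2 / d^2 <= q], the other at most [1/2 <= q]. *)
Lemma interval_split (R : realType) (F1 F2 : R -> R) (d e q s t : R) :
  0 < e -> e < d -> 2^-1 <= q -> e ^+ 2 <= q * d ^+ 2 -> s < t ->
  (forall x, s <= x <= t -> {for x, continuous F1} /\ {for x, continuous F2}) ->
  (forall u v, s <= u -> u < v -> v <= t ->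
    slope F1 u v ^+ 2 <= slope F2 u v <= slope F1 u v ^+ 2 + e ^+ 2) ->
  `|slope F1 s t| <= d -> 2 * d * `|slope F1 s t| < slope F2 s t ->
  exists m, [/\ s < m < t, m - s <= q * (t - s) /\ t - m <= q * (t - s),
    `|slope F1 s m| <= d \/ slope F2 s m <= 2 * d * `|slope F1 s m| &
    `|slope F1 m t| <= d \/ slope F2 m t <= 2 * d * `|slope F1 m t|].
Proof.
move=> e0 ed q2 qe st cF F12 x1d xc.
have [l tE] : exists l, t = s + l by exists (t - s); ring.
subst t.
have l0 : 0 < l by lra.
have l0' : l != 0 by rewrite gt_eqF.
have d2 : 0 < d ^+ 2 by apply: exprn_gt0; lra.
have /andP[_ xs] := F12 s (s + l) (lexx _) st (lexx _).
have alt_r r : 2^-1 <= r -> r * d ^+ 2 <= e ^+ 2 ->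
  [/\ 0 < r * l, r * l < l, r * l <= q * l & l - r * l <= q * l].
  move=> r2 rd; have rq : r <= q by rewrite -(ler_pM2r d2); lra.
  have r1 : r < 1.
    rewrite -(ltr_pM2r d2) (le_lt_trans rd)// mul1r.
    by rewrite -subr_gt0 subr_sqr; apply: mulr_gt0; lra.
  split; [by apply: mulr_gt0; lra|by rewrite gtr_pMl//| by rewrite ler_pM2r|].
  by rewrite -[X in X - _]mul1r -mulrBl ler_pM2r//; lra.
have bnd r : 2^-1 <= r <= 1 -> 0 < r * l <= l.
  move=> /andP[r0 r1]; rewrite ger_pMl// r1 andbT; apply: mulr_gt0; lra.
have bnd1 r : 2^-1 <= r < 1 -> 0 < r * l < l.
  move=> /andP[r0 r1]; rewrite gtr_pMl// r1 andbT; apply: mulr_gt0; lra.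
have wgt F r : 2^-1 <= r < 1 ->
  r * slope F s (s + r * l) + (1 - r) * slope F (s + r * l) (s + l) = slope F s (s
    + l) /\
  r * slope F ((s + l) - r * l) (s + l) + (1 - r) * slope F s ((s + l) - r * l) =
    slope F s (s + l).
  move=> /bnd1 /andP[rl0 rl1]; have ll : s + l - s = l by ring.
  split; apply: (mulfI l0').
    have := @slope_mid _ F s (s + r * l) (s + l) ltac:(lra) ltac:(lra).
    have -> : s + r * l - s = r * l by ring.
    have -> : s + l - (s + r * l) = (1 - r) * l by ring.
    by rewrite ll => <-; ring.
  have := @slope_mid _ F s (s + l - r * l) (s + l) ltac:(lra) ltac:(lra).
  have -> : s + l - r * l - s = (1 - r) * l by ring.
  have -> : s + l - (s + l - r * l) = r * l by ring.
  by rewrite ll => <-; ring.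
have e1 : s + 1 * l = (s + l) by ring.
have e2 : (s + l) - 1 * l = s by ring.
have [bad|left_ok] := pselect (d < `|slope F1 s (s + 2^-1 * l)| /\
    2 * d * `|slope F1 s (s + 2^-1 * l)| < slope F2 s (s + 2^-1 * l)).
  have [||||||r [r2 rd ry rz]] := @tangent_split R d e (slope F1 s (s + l)) (slope
    F2 s (s + l))
    (fun r => slope F1 s (s + r * l)) (fun r => slope F2 s (s + r * l))
    (fun r => slope F1 (s + r * l) (s + l)) (fun r =>
      slope F2 (s + r * l) (s + l)) e0 ed x1d xc xs.
  - by rewrite e1.
  - move=> r /[dup] rI /bnd /andP[rl0 rl1].
    have /cF[c1 c2] : s <= s + r * l <= (s + l) by lra.
    by split; apply: continuous_slope_l => //; rewrite gt_eqF//; lra.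
  - by move=> r /bnd /andP[rl0 rl1]; apply: F12; lra.
  - move=> r /[dup] rI /[dup] /bnd1 /andP[rl0 rl1] /wgt W; split;
    [exact: (W F1).1|exact: (W F2).1|].
    by have /andP[] := F12 (s + r * l) (s + l) ltac:(lra) ltac:(lra) ltac:(lra).
  - by case: bad.
  - by case: bad.
  have [rl0 rl1 rq1 rq2] := alt_r r r2 rd.
  by exists (s + r * l); split => //; [lra|lra].
have [bad|right_ok] := pselect (d < `|slope F1 ((s + l) - 2^-1 * l) (s + l)| /\
    2 * d * `|slope F1 ((s + l) - 2^-1 * l) (s + l)| < slope F2 ((s + l) - 2^-1 *
      l) (s + l)).
  have [||||||r [r2 rd ry rz]] := @tangent_split R d e (slope F1 s (s + l)) (slope
    F2 s (s + l))
    (fun r => slope F1 ((s + l) - r * l) (s + l)) (fun r =>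
      slope F2 ((s + l) - r * l) (s + l))
    (fun r => slope F1 s ((s + l) - r * l)) (fun r =>
      slope F2 s ((s + l) - r * l)) e0 ed x1d xc xs.
  - by rewrite e2.
  - move=> r /[dup] rI /bnd /andP[rl0 rl1].
    have /cF[c1 c2] : s <= (s + l) - r * l <= (s + l) by lra.
    by split; apply: continuous_slope_r => //; rewrite gt_eqF//; lra.
  - by move=> r /bnd /andP[rl0 rl1]; apply: F12; lra.
  - move=> r /[dup] rI /[dup] /bnd1 /andP[rl0 rl1] /wgt W; split;
    [exact: (W F1).2|exact: (W F2).2|].
    by have /andP[] := F12 s ((s + l) - r * l) ltac:(lra) ltac:(lra) ltac:(lra).
  - by case: bad.
  - by case: bad.
  have [rl0 rl1 rq1 rq2] := alt_r r r2 rd.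
  by exists ((s + l) - r * l); split => //; [lra|lra].
exists (s + 2^-1 * l); split.
- by lra.
- by split; nra.
- have [|?] := leP `|slope F1 s (s + 2^-1 * l)| d; first by left.
  by right; rewrite leNgt; apply/negP => ?; apply: left_ok.
- have mE : s + 2^-1 * l = (s + l) - 2^-1 * l by field.
  rewrite mE; have [|?] := leP `|slope F1 ((s + l) - 2^-1 * l) (s + l)| d;
    first by left.
  by right; rewrite leNgt; apply/negP => ?; apply: right_ok.
Qed.

(** The limit point may be a common endpoint of the intervals, so the conclusion speaks of intervals
    that contain [x], possibly at an end. *)
Lemma nested_intervals (R : realType) (P : R -> R -> Prop) (q a b : R) :
  0 <= q < 1 -> a < b -> P a b ->
  (forall s t, a <= s -> s < t -> t <= b -> P s t ->
    exists s' t', [/\ s <= s', s' < t', t' <= t, t' - s' <= q * (t - s) & P s' t']) ->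
  exists x, a <= x <= b /\ forall r, 0 < r ->
    exists s t, [/\ a <= s <= x, x <= t <= b, s < t, t - s < r & P s t].
Proof.
move=> /andP[q0 q1] ab Pab step.
pose T := {p : R * R | [/\ a <= p.1, p.1 < p.2, p.2 <= b & P p.1 p.2]}.
pose nxt (p p' : T) := [/\ (sval p).1 <= (sval p').1, (sval p').2 <= (sval p).2 &
  (sval p').2 - (sval p').1 <= q * ((sval p).2 - (sval p).1)].
have p0 : T by exists (a, b); split.
have [|f [f0 fS]] := @dependent_choice T nxt _ p0.
  move=> [[s t] [/= as_ st tb Pst]]; apply: cid.
  have [s' [t' [ss st' tt l P']]] := step s t as_ st tb Pst.
  by exists (exist _ (s', t') (And4 (le_trans as_ ss) st' (le_trans tt tb) P')).
pose u n := (sval (f n)).1; pose v n := (sval (f n)).2.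
have fP n : [/\ a <= u n, u n < v n, v n <= b & P (u n) (v n)] by exact: (svalP (f n)).
have uI m n : (m <= n)%N -> u m <= u n.
  apply: (@homo_leq _ u (fun x y => x <= y)) => //; first by move=> y x z;
    exact: le_trans.
  by move=> k; have [] := fS k.
have vI m n : (m <= n)%N -> v n <= v m.
  apply: (@homo_leq _ v (fun x y => y <= x)) => //; first by move=> y x z yx zy;
    exact: le_trans zy yx.
  by move=> k; have [] := fS k.
have uv m n : u m <= v n.
  have [_ k1 _ _] := fP (maxn m n).
  apply: le_trans (uI _ _ (leq_maxl m n)) _.
  exact: le_trans (ltW k1) (vI _ _ (leq_maxr m n)).
have len n : v n - u n <= q ^+ n * (v 0 - u 0).
  elim: n => [|n IH]; first by rewrite expr0 mul1r.
  have [_ _ L] := fS n; apply: le_trans L _.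
  by rewrite exprS -mulrA ler_wpM2l.
have ubu : has_sup (range u).
  by split; [exists (u 0), 0 | exists (v 0) => _ [n _ <-]; exact: uv].
have ux n : u n <= sup (range u) by apply: sup_upper_bound ubu _ _; exists n.
have xv n : sup (range u) <= v n.
  by apply: ge_sup; [exact: ubu.1|move=> _ [m _ <-]; exact: uv].
exists (sup (range u)); split.
  have [a0 _ _ _] := fP 0; have [_ _ b0 _] := fP 0.
  by rewrite (le_trans a0 (ux 0))// (le_trans (xv 0) b0).
move=> r r0.
have [n nr] : exists n, q ^+ n * (v 0 - u 0) < r.
  have : geometric (v 0 - u 0) q @ \oo --> (0 : R) by apply: cvg_geometric;
    rewrite ger0_norm.
  move=> /cvgrPdist_lt /(_ r r0) [n _ nr]; exists n.
  have /= := nr n (leqnn n); rewrite sub0r normrN mulrC; exact/le_lt_trans/ler_norm.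
have [a0 uvn b0 Pn] := fP n.
exists (u n), (v n); split; rewrite ?a0 ?b0 ?ux ?xv//.
exact: le_lt_trans (len n) nr.
Qed.

(** In the limit [2 d |p| <= p^2 <= d |p|]. With errors at most [k] this becomes
    [d |p| < k (|p| + 1 + 2 d)], which dictates the value of [k] that is tried. *)
Lemma chord_limit (R : realFieldType) (d p : R) : 0 < d ->
  (forall k, 0 < k -> exists x1 x2 : R, [/\ `|x1 - p| <= k,
    `|x2 - p ^+ 2| <= k, `|x1| <= d & 2 * d * `|x1| < x2]) -> p = 0.
Proof.
move=> d0 close.
apply/eqP/negPn/negP => pn0; have n0 : 0 < `|p| by rewrite normr_gt0.
have [|x1 [x2 [k1 k2 x1d' x12]]] := close (d * `|p| / (2 * (`|p| + 1 + 2 * d))).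
  by apply: divr_gt0; [apply: mulr_gt0|lra].
move: k1 k2; set k := _ / _ => k1 k2.
have kE : k * (2 * (`|p| + 1 + 2 * d)) = d * `|p| by rewrite divfK// gt_eqF//; lra.
have np : `|p| <= `|x1| + k.
  have -> : p = x1 - (x1 - p) by ring.
  by apply: le_trans (ler_normB _ _) _; rewrite lerD2l.
have x2p : x2 <= `|p| ^+ 2 + k.
  by rewrite real_normK ?num_real//; have := ler_norm (x2 - p ^+ 2); lra.
have : 2 * d * (`|p| - k) <= 2 * d * `|x1| by rewrite ler_pM2l; lra.
have : `|p| * `|p| <= `|p| * (d + k) by rewrite ler_pM2l//; lra.
have := mulr_gt0 d0 n0.
by lra.
Qed.

(* If the conclusion fails, there are nested intervals that are never discarded
   and on which G + K V - c F2 has slope at most -eta. Their limit point is not one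
   near which V has slope 1, because c F2 has slope at most 2 c d^2 < K on these
   intervals; so (F1, F2) has a derivative (p, p^2) there, and p = 0 by
   chord_limit. *)
Lemma stopping_time (R : realType) (F1 F2 G : R -> R) (a b d e c : R) :
  a < b -> 0 < e -> e < d -> 0 <= c ->
  (forall x, a <= x <= b -> {for x, continuous F1} /\ {for x, continuous F2}) ->
  (forall u v, a <= u -> u < v -> v <= b ->
    slope F1 u v ^+ 2 <= slope F2 u v <= slope F1 u v ^+ 2 + e ^+ 2) ->
  (forall u v, a <= u -> u < v -> v <= b ->
    slope F2 u v <= 2 * d * `|slope F1 u v| ->
    c * slope F2 u v <= slope G u v) ->
  (forall u v, a <= u -> u < v -> v <= b -> 0 <= slope G u v) ->
  (forall eta, 0 < eta -> exists V : R -> R,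
    [/\ V b - V a < eta,
      forall u v, a <= u -> u < v -> v <= b -> 0 <= slope V u v &
      forall x, a <= x <= b ->
        (exists2 r, 0 < r & forall u v, a <= u <= x -> x <= v <= b -> u < v ->
          v - u < r -> slope V u v = 1) \/
        (exists p, forall k, 0 < k -> exists2 r, 0 < r &
          forall u v, a <= u <= x -> x <= v <= b -> u < v -> v - u < r ->
          `|slope F1 u v - p| <= k /\ `|slope F2 u v - p ^+ 2| <= k)]) ->
  `|slope F1 a b| <= d -> c * slope F2 a b <= slope G a b.
Proof.
move=> ab e0 ed c0 cF F12 Gstop G0 loc x1d.
have d0 : 0 < d by lra.
rewrite leNgt; apply/negP => Gc.
have xc : 2 * d * `|slope F1 a b| < slope F2 a b.
  rewrite ltNge; apply/negP => /(Gstop a b (lexx _) ab (lexx _)); lra.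
(* Half of the deficit: the other half pays for the term [K V], whose slope over [[a, b]] is kept
   below [eta]. *)
have [eta etaE] : exists eta, eta = (c * slope F2 a b - slope G a b) / 2 by eexists.
have eta0 : 0 < eta by lra.
have [K KE] : exists K, K = 2 * c * d ^+ 2 + 1 by eexists.
have cdd : 0 <= c * d ^+ 2 by apply: mulr_ge0 => //; exact: sqr_ge0.
have K0 : 0 < K by lra.
have [|V [Vs V0 Vloc]] := loc (eta * (b - a) / K).
  by apply: divr_gt0 => //; apply: mulr_gt0; lra.
pose w s t := slope G s t + K * slope V s t - c * slope F2 s t.
pose P s t := [/\ `|slope F1 s t| <= d,
  2 * d * `|slope F1 s t| < slope F2 s t & w s t <= - eta].
have [q [q0 q1 q2 qe]] : exists q, [/\ 0 <= q, q < 1, 2^-1 <= q & e ^+ 2 <= q * d ^+ 2].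
  have ee : e ^+ 2 < d ^+ 2 by rewrite ltr_pXn2r// nnegrE; lra.
  have dd0 : 0 < d ^+ 2 by apply: exprn_gt0.
  have e1 : e ^+ 2 / d ^+ 2 < 1 by rewrite ltr_pdivrMr// mul1r.
  exists (Num.max 2^-1 (e ^+ 2 / d ^+ 2)); split.
  - by rewrite le_max; apply/orP; left; lra.
  - by rewrite gt_max e1 andbT; lra.
  - by rewrite le_max lexx.
  - by rewrite -ler_pdivrMr// le_max lexx orbT.
have Pab : P a b.
  split => //; rewrite /w.
  have : K * slope V a b <= eta.
    rewrite /slope mulrA ler_pdivrMr; last lra.
    by rewrite mulrC -ler_pdivlMr//; apply: ltW.
  by lra.
(* A discarded interval has [w >= 0] by [Gstop]. So a child with [w <= - eta] is above the chords,
   and the alternative given by [interval_split] leaves only [|x1| <= d]. *)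
have Pstep s t : a <= s -> s < t -> t <= b ->
  `|slope F1 s t| <= d \/ slope F2 s t <= 2 * d * `|slope F1 s t| ->
    w s t <= - eta -> P s t.
  move=> as_ st tb dj ws.
  have F2s : 2 * d * `|slope F1 s t| < slope F2 s t.
    rewrite ltNge; apply/negP => /(Gstop _ _ as_ st tb) Gs.
    have := mulr_ge0 (ltW K0) (V0 s t as_ st tb).
    by move: ws; rewrite /w; lra.
  by split => //; case: dj => //; rewrite leNgt F2s.
have [||x [xab xP]] := @nested_intervals R P q a b _ ab Pab; first by rewrite q0.
  move=> s t as_ st tb [x1s x2s ws].
  have [||m [/andP[sm mt] [l1 l2] g1 g2]] :=
    @interval_split R F1 F2 d e q s t e0 ed q2 qe st _ _ x1s x2s.
  - by move=> y /andP[sy yt]; apply: cF; rewrite (le_trans as_ sy) (le_trans yt tb).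
  - by move=> u v su uv vt; apply: F12 => //; [apply: le_trans su|apply: le_trans tb].
  (* [w] of the parent is the weighted mean of [w] over the children, so one child inherits the
     bound [- eta]. *)
  have wE : (m - s) * w s m + (t - m) * w m t = (t - s) * w s t.
    have := slope_mid G sm mt; have := slope_mid V sm mt; have := slope_mid F2 sm mt.
    rewrite /w => e2 ev eg.
    have -> : (t - s) * (slope G s t + K * slope V s t - c * slope F2 s t) =
      (t - s) * slope G s t + K * ((t - s) * slope V s t) - c * ((t - s) * slope F2
        s t) by ring.
    by rewrite -e2 -ev -eg; ring.
  have [w1|w1] := leP (w s m) (- eta).
    exists s, m; split => //; first by apply: le_trans (ltW mt) _.
    by apply: Pstep => //; apply: le_trans (ltW mt) _.
  have [w2|w2] := leP (w m t) (- eta).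
    exists m, t; split => //; first exact: ltW.
    by apply: Pstep => //; apply: le_trans as_ (ltW sm).
  have : (m - s) * - eta < (m - s) * w s m by rewrite ltr_pM2l//; lra.
  have : (t - m) * - eta < (t - m) * w m t by rewrite ltr_pM2l//; lra.
  have : (t - s) * w s t <= (t - s) * - eta by rewrite ler_pM2l//; lra.
  by rewrite -wE; lra.
have [[r r0 rV]|[p pF]] := Vloc x xab.
  have [s [t [asx xtb st tr [x1s x2s ws]]]] := xP r r0.
  have /andP[as_ sx] := asx; have /andP[xt tb] := xtb.
  have /andP[_ xs] := F12 s t as_ st tb.
  have [_ x2d] := tangent_point_lt e0 ed x1s x2s xs.
  have := G0 s t as_ st tb.
  have : c * slope F2 s t <= c * (2 * d ^+ 2) by apply: ler_wpM2l => //; apply: ltW.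
  by move: ws; rewrite /w (rV s t asx xtb st tr); lra.
have close k : 0 < k -> exists x1 x2 : R, [/\ `|x1 - p| <= k, `|x2 - p ^+ 2| <= k,
  `|x1| <= d, 2 * d * `|x1| < x2 & eta <= c * x2].
  move=> k0; have [r r0 rF] := pF k k0.
  have [s [t [asx xtb st tr [x1s x2s ws]]]] := xP r r0.
  have /andP[as_ sx] := asx; have /andP[xt tb] := xtb.
  exists (slope F1 s t), (slope F2 s t); have [f1 f2] := rF s t asx xtb st tr.
  split => //; have := G0 s t as_ st tb.
  have := mulr_ge0 (ltW K0) (V0 s t as_ st tb).
  by move: ws; rewrite /w; lra.
have p0 : p = 0.
  apply: (chord_limit d0) => k /close[x1 [x2 [c1 c2 c3 c4 _]]].
  by exists x1, x2.
(* Now that [p = 0], [x2] tends to 0, against [eta <= c x2]. *)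
have [|x1 [x2 [_ k2 _ _ x2c]]] := close (eta / (2 * (c + 1))).
  by apply: divr_gt0 => //; lra.
have : x2 <= eta / (2 * (c + 1)).
  by move: k2; rewrite p0 expr0n /= subr0; apply: le_trans; exact: ler_norm.
rewrite ler_pdivlMr; last lra.
move=> x2e; have : 0 <= x2.
  by rewrite leNgt; apply/negP => x20; have := mulr_ge0_le0 c0 (ltW x20); lra.
by lra.
Qed.

(** * Lower bounds for h *)

Lemma MVT_pos (R : realType) (f df : R -> R) (a b : R) : 0 <= a -> a < b ->
  {within `[0, +oo[, continuous f} ->
  (forall t : R, 0 < t -> is_derive t 1 f (df t)) ->
  exists2 c, a < c < b & f b - f a = df c * (b - a).
Proof.
move=> a0 ab fc fd.
have [||c] := @MVT R f df a b ab.
- by move=> x; rewrite in_itv /= => /andP[ax _]; apply: fd; apply: le_lt_trans ax.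
- apply: continuous_subspaceW fc => x; rewrite /= !in_itv /= andbT => /andP[ax _].
  exact: le_trans ax.
by rewrite in_itv /= => ? ?; exists c.
Qed.

Lemma MVT_gt0 (R : realType) (f df : R -> R) (a b : R) : 0 < a -> a < b ->
  (forall t : R, 0 < t -> is_derive t 1 f (df t)) ->
  exists2 c, a < c < b & f b - f a = df c * (b - a).
Proof.
move=> a0 ab fd.
have [||c] := @MVT R f df a b ab.
- by move=> x; rewrite in_itv /= => /andP[ax _]; apply: fd; apply: lt_trans ax.
- apply: derivable_within_continuous => x; rewrite in_itv /= => /andP[ax _].
  by have [] := fd x (lt_le_trans a0 ax).
by rewrite in_itv /= => ? ?; exists c.
Qed.

(* f stands for h minus the quadratic Q with Q(0) = h(0) and with the same
   value and slope as h at T. *)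
Lemma third_derivative_ge0 (R : realType) (f f1 f2 : R -> R) (T : R) : 0 < T ->
  {within `[0, +oo[, continuous f} ->
  (forall t : R, 0 < t -> is_derive t 1 f (f1 t)) ->
  (forall t : R, 0 < t -> is_derive t 1 f1 (f2 t)) ->
  (forall s t : R, 0 < s -> s < t -> f2 s < f2 t) ->
  f 0 = 0 -> f T = 0 -> f1 T = 0 -> forall t, 0 <= t -> 0 <= f t.
Proof.
move=> T0 fc fd f1d f2i f00 fT f1T t t0; rewrite leNgt; apply/negP => ft.
have tn0 : 0 < t by rewrite lt_neqAle t0 andbT; apply/eqP => E;
  rewrite -E f00 in ft; lra.
(* The mean value theorem, used twice, shows that a negative value contradicts the growth of [f2].
   If [t < T], then [f1] is negative, later positive, and 0 at [T]. If [T < t], then [f1] vanishes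
   at some [x < T] and at [T], and is negative later. *)
have [tT|Tt|E] := ltgtP t T; last by rewrite E fT in ft; lra.
- have [p1 /andP[p10 p1t]] := MVT_pos (lexx 0) tn0 fc fd.
  have [p2 /andP[tp2 p2T]] := MVT_pos t0 tT fc fd.
  rewrite f00 fT => e2 e1.
  have f1p1 : f1 p1 < 0 by rewrite -(@pmulr_llt0 _ (t - 0)) -?e1; lra.
  have f1p2 : 0 < f1 p2 by rewrite -(@pmulr_lgt0 _ (T - t)) -?e2; lra.
  have [q1 /andP[pq1 q1p] e3] := MVT_gt0 p10 (lt_trans p1t tp2) f1d.
  have [q2 /andP[pq2 q2p] e4] := MVT_gt0 (lt_trans tn0 tp2) p2T f1d.
  have f2q1 : 0 < f2 q1 by rewrite -(@pmulr_lgt0 _ (p2 - p1)) -?e3; lra.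
  have f2q2 : f2 q2 < 0 by rewrite -(@pmulr_llt0 _ (T - p2)) -?e4 ?f1T; lra.
  by have := f2i q1 q2 (lt_trans p10 pq1) (lt_trans q1p pq2); lra.
- have [p /andP[Tp pt]] := MVT_pos (ltW T0) Tt fc fd.
  have [x /andP[x0 xT]] := MVT_pos (lexx 0) T0 fc fd.
  rewrite f00 fT => e1 e2.
  have f1p : f1 p < 0 by rewrite -(@pmulr_llt0 _ (t - T)) -?e2; lra.
  have f1x : f1 x = 0 by apply: (@mulIf _ (T - 0)); [rewrite gt_eqF//;
    lra|rewrite -e1; lra].
  have [q1 /andP[pq1 q1p] e3] := MVT_gt0 x0 xT f1d.
  have [q2 /andP[pq2 q2p] e4] := MVT_gt0 T0 Tp f1d.
  have f2q1 : f2 q1 = 0 by apply: (@mulIf _ (T - x)); [rewrite gt_eqF//;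
    lra|rewrite -e3 f1T f1x; lra].
  have f2q2 : f2 q2 < 0 by rewrite -(@pmulr_llt0 _ (p - T)) -?e4 ?f1T; lra.
  by have := f2i q1 q2 (lt_trans x0 pq1) (lt_trans q1p pq2); lra.
Qed.

(* All that the argument uses about h; gauge_quadratic is where the convexity of
   h(t) / t, hence the sign of the third derivative, enters. *)
Record gauge (R : realType) (h : R -> R) : Prop := Gauge {
  gauge0 : h 0 = 0;
  gauge_lt : forall s t : R, 0 <= s -> s < t -> h s < h t;
  gauge_tangent : forall u : R, 0 < u -> exists2 m : R, 0 <= m &
    forall t : R, 0 <= t -> h t <= h u + m * (t - u);
  gauge_quadratic : forall T : R, 0 < T -> exists2 k : R, k <= 0 &
    forall t : R, 0 <= t -> h T / T * t + k * (t * (t - T)) <= h t;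
  gauge_continuous : continuous (fun x : R => h `|x|);
  gauge_surj : forall y : R, 0 <= y -> exists2 t : R, 0 <= t & h t = y }.

Lemma gauge_of_is_derive (R : realType) (h h1 h2 h3 : R -> R) :
  {within `[0, +oo[, continuous h} ->
  (forall t : R, 0 < t -> is_derive t 1 h (h1 t)) ->
  (forall t : R, 0 < t -> is_derive t 1 h1 (h2 t)) ->
  (forall t : R, 0 < t -> is_derive t 1 h2 (h3 t)) ->
  h 0 = 0 -> h t @[t --> +oo] --> +oo ->
  (forall t : R, 0 < t -> 0 < h1 t) -> (forall t : R, 0 < t -> h2 t < 0) ->
  (forall t : R, 0 < t -> 0 < h3 t) -> gauge h.
Proof.
move=> h_cont D1 D2 D3 h_0 h_infty h_d1 h_d2 h_d3.
have hlt (s t : R) : 0 <= s -> s < t -> h s < h t.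
  move=> s0 st; have [c /andP[sc ct] e] := MVT_pos s0 st h_cont D1.
  rewrite -subr_gt0 e; apply: mulr_gt0; last by rewrite subr_gt0.
  exact/h_d1/(le_lt_trans s0).
have h1lt (s t : R) : 0 < s -> s < t -> h1 t < h1 s.
  move=> s0 st; have [c /andP[sc ct] e] := MVT_gt0 s0 st D2.
  rewrite -subr_lt0 e nmulr_rlt0 ?subr_gt0//.
  exact/h_d2/(lt_trans s0).
have h2lt (s t : R) : 0 < s -> s < t -> h2 s < h2 t.
  move=> s0 st; have [c /andP[sc ct] e] := MVT_gt0 s0 st D3.
  rewrite -subr_gt0 e; apply: mulr_gt0; last by rewrite subr_gt0.
  exact/h_d3/(lt_trans s0).
have tg (u t : R) : 0 < u -> 0 <= t -> h t <= h u + h1 u * (t - u).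
  move=> u0 t0; have [tu|ut|->] := ltgtP t u; last by rewrite subrr mulr0 addr0.
    have [c /andP[tc cu] e] := MVT_pos t0 tu h_cont D1.
    have : h1 u * (u - t) < h1 c * (u - t).
      by rewrite ltr_pM2r ?subr_gt0//; exact: h1lt (le_lt_trans t0 tc) cu.
    by lra.
  have [c /andP[uc ct] e] := MVT_pos (ltW u0) ut h_cont D1.
  have : h1 c * (t - u) < h1 u * (t - u).
    by rewrite ltr_pM2r ?subr_gt0//; exact: h1lt u0 uc.
  by lra.
have cont_pos (y : R) : 0 < y -> {for y, continuous h}.
  move=> y0; apply/differentiable_continuous/derivable1_diffP.
  by have [] := D1 y y0.
split => //.
- by move=> u u0; exists (h1 u); [exact/ltW/h_d1|move=> t; exact: tg].
(* This [k] gives the quadratic the slope [h1 T] at [T]. It is nonpositive because the tangent at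
   [T] is above [h 0 = 0] at the origin, so that [h1 T <= h T / T]. *)
- move=> T T0; pose k := (h1 T - h T / T) / T; exists k.
    have := tg T 0 T0 (lexx 0); rewrite h_0 sub0r mulrN subr_ge0 => hT.
    rewrite /k pmulr_lle0 ?invr_gt0// subr_le0 ler_pdivlMr//.
  move=> t t0; rewrite -subr_ge0.
  pose g (y : R) := h T / T * y + k * (y * (y - T)).
  pose g1 (y : R) := h T / T + k * (y + (y - T)).
  have gD (y : R) : is_derive y 1 g (g1 y).
    apply/is_derive1_caratheodory; exists (fun z => h T / T + k * (z + (y - T))).
    split=> [z||//]; first by rewrite /g /=; ring.
    apply: cvgD; first exact: cvg_cst.
    apply: cvgM; first exact: cvg_cst.
    by apply: cvgD; [exact: cvg_id|exact: cvg_cst].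
  have g1D (y : R) : is_derive y 1 g1 (2 * k).
    apply/is_derive1_caratheodory; exists (cst (2 * k)).
    by split=> [z||//]; [rewrite /g1 /=; ring|exact: cvg_cst].
  have T0' : T != 0 by rewrite gt_eqF.
  have fge := @third_derivative_ge0 R (h - g) (h1 - g1) (h2 - cst (2 * k)) T T0.
  have gc : {within `[0, +oo[, continuous g}.
    apply: continuous_subspaceT => z; apply/differentiable_continuous/derivable1_diffP.
    by have [] := gD z.
  apply: (fge _ _ _ _ _ _ _ t t0).
  + by move=> y; apply: cvgB; [exact: h_cont|exact: gc].
  + by move=> y y0; have ? := D1 y y0; apply: is_deriveB.
  + by move=> y y0; have ? := D2 y y0; apply: is_deriveB.
  + by move=> s u s0 su; rewrite !fctE /= ltrD2r; exact: h2lt.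
  + by rewrite !fctE /g h_0; ring.
  + by rewrite !fctE /g; field.
  + by rewrite !fctE /g1 /k; field.
- move=> x; have [->|x0] := eqVneq x 0.
    have [_ c0] := (continuous_within_itvcyP 0 h).1 h_cont.
    apply/left_right_continuousP; rewrite normr0; split.
      have c0' : h (- y) @[y --> 0^'-] --> h 0.
        by move/cvg_at_rightNP : c0; rewrite oppr0.
      apply: cvg_trans c0'; apply: near_eq_cvg; near=> y.
      by rewrite ltr0_norm//; near: y; exact: nbhs_left_lt.
    apply: cvg_trans c0; apply: near_eq_cvg; near=> y.
    by rewrite gtr0_norm//; near: y; exact: nbhs_right_gt.
  apply: (@continuous_comp R R R (fun x => `|x|) h); first exact: norm_continuous.
  by apply: cont_pos; rewrite normr_gt0.
- move=> y y0.
  have [M [M0 yM]] : exists M, 0 <= M /\ y <= h M.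
    have := h_infty; move/cvgryPge => /(_ y) [M [_ HM]].
    exists (`|M| + 1); split; first by rewrite addr_ge0.
    by apply: HM; apply: le_lt_trans (ler_norm M) _; rewrite ltrDl.
  have [||t] := @IVT R h 0 M y M0.
  + by apply: continuous_subspaceW h_cont => x; rewrite /= !in_itv /= andbT => /andP[].
  + by rewrite ge_min le_max h_0 y0 yM orbT.
  by rewrite in_itv /= => /andP[t0 _] <-; exists t.
Unshelve. all: by end_near. Qed.

Lemma gauge_of_derivatives (R : realType) (h : R -> R) :
  {within `[0, +oo[, continuous h} ->
  (forall t : R, 0 < t ->
    [/\ derivable h t 1, derivable h^`(1) t 1 & derivable h^`(2) t 1]) ->
  h 0 = 0 -> h t @[t --> +oo] --> +oo ->
  (forall t : R, 0 < t -> 0 < h^`(1) t) ->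
  (forall t : R, 0 < t -> h^`(2) t < 0) ->
  (forall t : R, 0 < t -> 0 < h^`(3) t) -> gauge h.
Proof.
move=> h_cont h_diff h_0 h_infty h_d1 h_d2 h_d3.
apply: (@gauge_of_is_derive R h h^`(1) h^`(2) h^`(3) h_cont _ _ _ h_0 h_infty h_d1
  h_d2 h_d3) => t /h_diff[d1 d2 d3].
- by have := derivableP d1; rewrite -derive1E -derive1n1.
- by have := derivableP d2; rewrite -derive1E -derive1nS.
- by have := derivableP d3; rewrite -derive1E -derive1nS.
Qed.

Lemma gauge_le (R : realType) (h : R -> R) (s t : R) : gauge h ->
  0 <= s -> s <= t -> h s <= h t.
Proof.
by move=> gh s0; rewrite le_eqVlt => /predU1P[->//|st]; apply/ltW/gauge_lt.
Qed.

Lemma gauge_ge0 (R : realType) (h : R -> R) (t : R) : gauge h ->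
  0 <= t -> 0 <= h t.
Proof. by move=> gh t0; rewrite -(gauge0 gh); exact: gauge_le. Qed.

Lemma gauge_gt0 (R : realType) (h : R -> R) (t : R) : gauge h ->
  0 < t -> 0 < h t.
Proof. by move=> gh t0; rewrite -(gauge0 gh); exact: gauge_lt. Qed.

Lemma gauge_inj (R : realType) (h : R -> R) (s t : R) : gauge h ->
  0 <= s -> 0 <= t -> h s = h t -> s = t.
Proof.
move=> gh s0 t0 E; have [st|ts|//] := ltgtP s t.
  by have := gauge_lt gh s0 st; rewrite E ltxx.
by have := gauge_lt gh t0 ts; rewrite E ltxx.
Qed.

(** Eliminate the slope [m] of the tangent at [t] between its values at [0] and at [T]. The result
    expresses that [h(t) / t] is nonincreasing. *)
Lemma gauge_chord (R : realType) (h : R -> R) (t T : R) : gauge h ->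
  0 <= t -> t <= T -> t * h T <= T * h t.
Proof.
move=> gh; rewrite le_eqVlt => /predU1P[<- T0|t0 tT].
  by rewrite mul0r mulr_ge0// gauge_ge0.
have [m _ mh] := gauge_tangent gh t0.
have := mh T (le_trans (ltW t0) tT); have := mh 0 (lexx 0);
  rewrite (gauge0 gh) => h0 hT.
have : t * h T <= t * (h t + m * (T - t)) by rewrite ler_pM2l.
have : 0 <= (T - t) * (h t + m * (0 - t)) by apply: mulr_ge0 => //; lra.
by lra.
Qed.

(** For [x < 0] both terms of the quadratic are nonpositive, so the bound for [t >= 0] extends to
    the even function [h |x|]. *)
Lemma gauge_minorant (R : realType) (h : R -> R) (T : R) : gauge h -> 0 < T ->
  exists2 k : R, k <= 0 & forall x : R, h T / T * x + k * (x * (x - T)) <= h `|x|.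
Proof.
move=> gh T0; have [k k0 kh] := gauge_quadratic gh T0; exists k => // x.
have [x0|x0] := leP 0 x; first by rewrite ger0_norm//; exact: kh.
apply: le_trans (gauge_ge0 gh (normr_ge0 x)).
have hT : 0 <= h T / T by apply: divr_ge0; [apply: gauge_ge0|]; rewrite ?ltW.
have := mulr_ge0_le0 hT (ltW x0).
have : k * (x * (x - T)) <= 0 by apply: mulr_le0_ge0 => //; rewrite nmulr_rge0//; lra.
by lra.
Qed.

(** The parabola vanishes at [0] and [4 T] and peaks at [2 T] with value [h T]. For [0 <= x <= T] it
    is below the chord of [h], for [x > T] it is below [h T]. It serves for intervals whose mean has
    absolute value [T > d]. *)
Lemma gauge_parabola (R : realType) (h : R -> R) (T x : R) : gauge h -> 0 < T ->
  h T / T * (x - x ^+ 2 / (4 * T)) <= h `|x|.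
Proof.
move=> gh T0; have T0' : T != 0 by rewrite gt_eqF.
have hT : 0 <= h T by apply: gauge_ge0 => //; exact: ltW.
have hTT : 0 <= h T / T by apply: divr_ge0 => //; exact: ltW.
have sq0 : 0 <= x ^+ 2 / (4 * T) by apply: divr_ge0; [exact: sqr_ge0|lra].
have [x0|x0] := ltP x 0.
  apply: le_trans (gauge_ge0 gh (normr_ge0 x)).
  by apply: mulr_ge0_le0 => //; lra.
rewrite ger0_norm//; have [xT|Tx] := leP x T.
  apply: (@le_trans _ _ (h T / T * x)); first by rewrite ler_wpM2l//; lra.
  rewrite -mulrA [_^-1 * x]mulrC mulrA ler_pdivrMr// [h T * x]mulrC [h x * T]mulrC.
  exact: gauge_chord.
apply: le_trans (gauge_le gh (ltW T0) (ltW Tx)).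
rewrite -mulrA ger_pMr; last exact: gauge_gt0.
rewrite mulrC ler_pdivrMr// mul1r -subr_ge0.
have -> : T - (x - x ^+ 2 / (4 * T)) = (x - 2 * T) ^+ 2 / (4 * T) by field.
by apply: divr_ge0; [exact: sqr_ge0|lra].
Qed.

Lemma gauge_affine_bound (R : realType) (h : R -> R) : gauge h ->
  exists2 m : R, 0 <= m & forall x : R, h `|x| <= h 1 + m * `|x|.
Proof.
move=> gh; have [m m0 mh] := gauge_tangent gh (@ltr01 R); exists m => // x.
by apply: le_trans (mh _ (normr_ge0 x)) _; rewrite lerD2l ler_wpM2l//; lra.
Qed.

(** * Averages of locally integrable functions *)

Definition mean (R : realType) (s t : R) (f : R -> R) : R :=
  (t - s)^-1 * \int[leb]_(x in `[s, t]) f x.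

Section mean_linear.
Context {R : realType}.
Implicit Types (f g : R -> R) (a b s t : R).

Lemma loc_int_itv f a b : loc_int f -> leb.-integrable `[a, b] (EFin \o f).
Proof.
move=> [mf _ fK]; apply/integrableP; split.
  exact/measurable_EFinP/measurable_funTS.
by have := fK `[a, b] (@subsetT _ _) (@segment_compact _ _ _).
Qed.

Lemma loc_int_le f g : measurable_fun setT f -> loc_int g ->
  (forall x, `|f x| <= `|g x|) -> loc_int f.
Proof.
move=> mf [mg _ gK] fg; split => //; first exact: openT.
move=> K KT cK; apply: le_lt_trans (gK K KT cK).
apply: ge0_le_integral => //; first exact: compact_measurable.
- by apply/measurable_EFinP/measurableT_comp => //; exact: measurable_funTS.
- by apply/measurable_EFinP/measurableT_comp => //; exact: measurable_funTS.
- by move=> x _; rewrite lee_fin.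
Qed.

Lemma loc_int_cst (c : R) : loc_int (fun _ : R => c).
Proof.
split; [exact: measurable_cst|exact: openT|] => K _ cK.
rewrite integral_cst; last exact: compact_measurable.
by rewrite lte_mul_pinfty//; exact: compact_finite_measure.
Qed.

Lemma loc_intZ (c : R) f : loc_int f -> loc_int (fun x => c * f x).
Proof.
move=> [mf _ fK]; split; [exact: measurable_funM|exact: openT|] => K KT cK.
have mK : measurable K by exact: compact_measurable.
under eq_integral do rewrite normrM EFinM.
rewrite ge0_integralZl//; first by rewrite lte_mul_pinfty// fK.
by apply/measurable_EFinP/measurableT_comp => //; exact: measurable_funTS.
Qed.

Lemma loc_intD f g : loc_int f -> loc_int g -> loc_int (fun x => f x + g x).
Proof. exact: locally_integrableD. Qed.

Lemma mean_lin3 (A B C : R) f g s t : s < t -> loc_int f -> loc_int g ->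
  mean s t (fun x => A * f x + B * g x + C) = A * mean s t f + B * mean s t g + C.
Proof.
move=> st lf lg; rewrite /mean.
have mI : measurable (`[s, t]%classic : set R) by exact: measurable_itv.
rewrite (@RintegralD _ _ R leb _ (fun x => A * f x + B * g x) (fun=> C))//=;
  last 2 first.
- by apply: loc_int_itv; apply: loc_intD; exact: loc_intZ.
- exact/loc_int_itv/loc_int_cst.
rewrite (@RintegralD _ _ R leb _ (fun x => A * f x) (fun x => B * g x))//=;
  last 2 first.
- exact/loc_int_itv/loc_intZ.
- exact/loc_int_itv/loc_intZ.
rewrite RintegralZl//; last exact: loc_int_itv.
rewrite RintegralZl//; last exact: loc_int_itv.
rewrite Rintegral_cst//= lebesgue_measure_itv /= lte_fin st /=.
have : t - s != 0 by rewrite subr_eq0 gt_eqF.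
by move=> ?; field.
Qed.

Lemma mean_le f g s t : s < t -> loc_int f -> loc_int g ->
  (forall x, s <= x <= t -> f x <= g x) -> mean s t f <= mean s t g.
Proof.
move=> st lf lg fg; rewrite /mean ler_pM2l ?invr_gt0 ?subr_gt0//.
apply: le_Rintegral; [exact: measurable_itv|exact: loc_int_itv|exact: loc_int_itv|].
by move=> x; rewrite /= in_itv /=; exact: fg.
Qed.

End mean_linear.

(** * Primitives and Lebesgue differentiation *)

Definition prim (R : realType) (a : R) (f : R -> R) (x : R) : R :=
  \int[leb]_(y in `[a, x]) f y.

Lemma slope_prim (R : realType) (a s t : R) (f : R -> R) :
  a <= s -> s < t -> loc_int f -> slope (prim a f) s t = mean s t f.
Proof.
move=> as_ st lf; rewrite /slope /mean /prim mulrC; congr (_ * _).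
rewrite Rintegral_itvB //.
- rewrite Rintegral_itv_obnd_cbnd//.
  by apply: integrableS (loc_int_itv s t lf) => // x;
    rewrite /= !in_itv /= => /andP[/ltW-> ->].
- exact: loc_int_itv.
- by rewrite bnd_simp ltW.
Qed.

Lemma prim_continuous (R : realType) (a x : R) (f : R -> R) :
  a < x -> loc_int f -> {for x, continuous (prim a f)}.
Proof.
move=> ax lf.
have ab : a <= x + 1 by lra.
have := parameterized_integral_continuous ab (loc_int_itv a (x + 1) lf).
have ab' : a < x + 1 by lra.
move=> /(continuous_within_itvP _ ab')[cf _ _]; apply: cf.
by rewrite in_itv /= ax /=; lra.
Qed.

(** Split [F v - F u] at [x]: the errors of the two linear approximations are at most [k |v - x|]
    and [k |u - x|], and these distances add up to [v - u] because [x] lies between. *)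
Lemma derivable_straddle (R : realType) (F : R -> R) (x : R) :
  derivable F x 1 -> forall k : R, 0 < k -> exists2 r : R, 0 < r &
  forall u v : R, u <= x -> x <= v -> u < v -> v - u < r ->
  `|slope F u v - derive1 F x| <= k.
Proof.
move=> dF k k0.
have : h^-1 *: (F (h + x) - F x) @[h --> 0^'] --> derive1 F x.
  have := dF; rewrite /derivable /derive1 => /cvg_ex[l lF].
  have E : (fun h : R => h^-1 *: ((F \o shift x) (h *: 1) - F x)) = (fun h : R =>
    h^-1 *: (F (h + x) - F x)).
    by apply/funext => h /=; rewrite [_ *: 1]mulr1.
  by rewrite E in lF; rewrite (cvg_lim _ lF).
move=> /cvgrPdist_le /(_ k k0) [r /= r0 rF].
have near_x h : `|h| < r -> `|F (h + x) - F x - derive1 F x * h| <= k * `|h|.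
  have [->|h0] := eqVneq h 0; first by rewrite add0r subrr mulr0 subrr normr0 mulr0.
  move=> hr; have := rF h; rewrite /ball_ /= sub0r normrN => /(_ hr h0).
  rewrite -(ler_pM2r (_ : 0 < `|h|)) ?normr_gt0// -normrM.
  have -> : (derive1 F x - h^-1 *: (F (h + x) - F x)) * h = - (F (h + x) - F x -
    derive1 F x * h).
    by rewrite /GRing.scale /=; field.
  by rewrite normrN.
exists r => // u v ux xv uv uvr.
have v0 : 0 < v - u by lra.
rewrite -(ler_pM2r v0) -{1}(gtr0_norm v0) -normrM /slope.
have -> : ((F v - F u) / (v - u) - derive1 F x) * (v - u) =
  (F ((v - x) + x) - F x - derive1 F x * (v - x)) - (F ((u - x) + x) - F x -
    derive1 F x * (u - x)).
  by rewrite !subrK; field; lra.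
have nv : `|v - x| < r by rewrite ger0_norm; lra.
have nu : `|u - x| < r by rewrite ler0_norm; lra.
apply: le_trans (ler_normB _ _) _.
apply: le_trans (lerD (near_x _ nv) (near_x _ nu)) _.
by rewrite ger0_norm ?ler0_norm; lra.
Qed.

Lemma mean_ae (R : realType) (a : R) (f : R -> R) : loc_int f ->
  {ae leb, forall x : R, a < x -> forall k : R, 0 < k -> exists2 r : R, 0 < r &
  forall u v : R, a <= u -> u <= x -> x <= v -> u < v -> v - u < r ->
  `|mean u v f - f x| <= k}.
Proof.
move=> lf.
have [|N [mN N0 NS]] := @FTC1 R f (BLeft a) _ lf; first by move=> y; exact: loc_int_itv.
exists N; split => // x /= /not_implyP[ax /existsNP[k bad]]; apply: NS => /= good;
  apply: bad.
have [|dF FE] := good; first by rewrite lte_fin.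
move=> k0; have [r r0 rF] := derivable_straddle dF k0;
  exists r => // u v au ux xv uv uvr.
rewrite -(slope_prim au uv lf) -FE; exact: rF.
Qed.

(** * The lower bound for functions of known norm *)

Lemma mean_quadratic_le (R : realType) (A B C s t : R) (f g : R -> R) :
  s < t -> loc_int f -> loc_int (fun x => f x ^+ 2) -> loc_int g ->
  (forall x, s <= x <= t -> A * f x + B * f x ^+ 2 + C <= g x) ->
  A * mean s t f + B * mean s t (fun x => f x ^+ 2) + C <= mean s t g.
Proof.
move=> st lf lf2 lg fg; rewrite -mean_lin3//.
by apply: mean_le => //; do 2?[apply: loc_intD];
  do ?[exact: loc_int_cst|exact: loc_intZ].
Qed.

Lemma mean_sqr_ge (R : realType) (s t : R) (f : R -> R) :
  s < t -> loc_int f -> loc_int (fun x => f x ^+ 2) ->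
  mean s t f ^+ 2 <= mean s t (fun x => f x ^+ 2).
Proof.
move=> st lf lf2; set c := mean s t f.
have := @mean_quadratic_le R (2 * c) 0 (- c ^+ 2) s t f _ st lf lf2 lf2.
rewrite -/c mul0r => H; have : 2 * c * c + 0 - c ^+ 2 <= mean s t (fun x => f x ^+ 2).
  by apply: H => x _; have := sqr_ge0 (f x - c); lra.
by apply: le_trans; rewrite addr0; lra.
Qed.

Lemma mean_ge0 (R : realType) (s t : R) (f : R -> R) :
  s < t -> loc_int f -> (forall x, 0 <= f x) -> 0 <= mean s t f.
Proof.
move=> st lf f0; apply: mulr_ge0; first by rewrite invr_ge0 subr_ge0 ltW.
by apply: Rintegral_ge0.
Qed.

Lemma gauge_loc_int (R : realType) (h : R -> R) (f : R -> R) :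
  gauge h -> loc_int f -> loc_int (fun x => h `|f x|).
Proof.
move=> gh lf; have [m m0 mh] := gauge_affine_bound gh.
have h1 : 0 <= h 1 by apply: gauge_ge0.
have [mf _ _] := lf.
have lnf : loc_int (fun x => `|f x|).
  by apply: (loc_int_le _ lf) => [|x]; [exact: measurableT_comp|rewrite normr_id].
apply: (@loc_int_le R _ (fun x => h 1 + m * `|f x|)).
- have mu_h : measurable_fun setT (fun x : R => h `|x|).
    by apply: continuous_measurable_fun; exact: gauge_continuous.
  exact: (measurableT_comp mu_h mf).
- by apply: loc_intD; [exact: loc_int_cst|exact: loc_intZ].
- move=> x; rewrite (ger0_norm (gauge_ge0 gh (normr_ge0 _))) [leRHS]ger0_norm//.
  by rewrite addr_ge0// mulr_ge0.
Qed.

(* An interval on which <f^2> <= 2 d |<f>| can be discarded: its Bellman point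
   lies under one of the two chords from (0, 0) to (+-2d, 4d^2). *)
Lemma stopped_bound (R : realType) (h f : R -> R) (d s t : R) :
  gauge h -> 0 < d -> s < t -> loc_int f -> loc_int (fun x => f x ^+ 2) ->
  mean s t (fun x => f x ^+ 2) <= 2 * d * `|mean s t f| ->
  h (2 * d) / (4 * d ^+ 2) * mean s t (fun x => f x ^+ 2) <=
  mean s t (fun x => h `|f x|).
Proof.
move=> gh d0 st lf lf2; have lh := gauge_loc_int gh lf.
set X1 := mean s t f; set X2 := mean s t _; set H := mean s t _ => X12.
have T0 : 0 < 2 * d by lra.
have [k k0 kh] := gauge_minorant gh T0.
set p := h (2 * d) / (2 * d) in kh.
have p0 : 0 <= p by apply: divr_ge0; [apply: (gauge_ge0 gh)|]; lra.
have b1 : (p - k * (2 * d)) * X1 + k * X2 + 0 <= H.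
  apply: mean_quadratic_le => // x _; apply: le_trans (kh (f x)).
  by rewrite -subr_ge0; set y := (X in 0 <= X); have -> : y = 0 by rewrite /y; ring.
have b2 : - (p - k * (2 * d)) * X1 + k * X2 + 0 <= H.
  apply: mean_quadratic_le => // x _; rewrite -(normrN (f x));
    apply: le_trans (kh (- f x)).
  by rewrite -subr_ge0; set y := (X in 0 <= X); have -> : y = 0 by rewrite /y; ring.
have b : p * `|X1| + k * (X2 - 2 * d * `|X1|) <= H.
  by have [x0|x0] := leP 0 X1; [rewrite ger0_norm//|rewrite ltr0_norm//]; lra.
apply: le_trans b.
have -> : h (2 * d) / (4 * d ^+ 2) * X2 = p / (2 * d) * X2 by rewrite /p; field; lra.
have : p / (2 * d) * X2 <= p / (2 * d) * (2 * d * `|X1|).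
  by rewrite ler_wpM2l// divr_ge0//; lra.
have -> : p / (2 * d) * (2 * d * `|X1|) = p * `|X1| by field; lra.
have : 0 <= k * (X2 - 2 * d * `|X1|) by apply: mulr_le0 => //; lra.
by lra.
Qed.

(** Outer regularity, applied to the null set where differentiation fails for [f] or [f^2]. Openness
    matters: every short interval around a point of [U] lies in [U], so the primitive of the
    indicator of [U] has slope 1 there. *)
Lemma exceptional_open_set (R : realType) (f : R -> R) (a b eta : R) :
  a < b -> loc_int f -> loc_int (fun x => f x ^+ 2) -> 0 < eta ->
  exists U : set R, [/\ open U, (leb U < eta%:E)%E &
    forall x : R, a <= x <= b -> U x \/ forall k : R, 0 < k -> exists2 r : R, 0 < r &
      forall u v : R, a <= u -> u <= x -> x <= v -> u < v -> v - u < r ->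
      `|mean u v f - f x| <= k /\
      `|mean u v (fun x => f x ^+ 2) - f x ^+ 2| <= k].
Proof.
move=> ab lf lf2 eta0.
have [N1 [mN1 N10 NS1]] := mean_ae (a - 1) lf.
have [N2 [mN2 N20 NS2]] := mean_ae (a - 1) lf2.
have mN : measurable (N1 `|` N2) by exact: measurableU.
have N0 : leb (N1 `|` N2) = 0.
  apply/eqP; rewrite eq_le measure_ge0 andbT.
  by apply: le_trans (measureU2 _ _ _) _ => //;
    rewrite [X in (X + _)%E]N10 [X in (_ + X)%E]N20 adde0.
have [|U [oU NU Ueta]] := lebesgue_regularity_outer mN _ eta0.
  by rewrite [X in (X < _)%E]N0.
exists U; split => //.
  have mU := open_measurable oU.
  rewrite -(setDUK NU) measureU//; first by rewrite [X in (X + _)%E]N0 add0e.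
    exact: measurableD.
  by rewrite setDE setICA setICr setI0.
move=> x /andP[ax xb]; have [Nx|nNx] := pselect ((N1 `|` N2) x); first by left;
  exact: NU.
right => k k0.
have g1 := contrapT (fun H => nNx (or_introl (NS1 x H))).
have g2 := contrapT (fun H => nNx (or_intror (NS2 x H))).
have ax' : a - 1 < x by lra.
have [r1 r10 H1] := g1 ax' k k0; have [r2 r20 H2] := g2 ax' k k0.
exists (Num.min r1 r2); first by rewrite lt_min r10.
move=> u v au ux xv uv; rewrite lt_min => /andP[l1 l2].
have au' : a - 1 <= u by lra.
by split; [exact: H1|exact: H2].
Qed.

(** For [e >= 0], the bound [e] on the norm over [[a, b]], free of square roots, extended reals and
    the various kinds of endpoints. *)
Definition bmo_le (R : realType) (f : R -> R) (a b e : R) :=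
  forall u v : R, a <= u -> u < v -> v <= b ->
    mean u v (fun x => f x ^+ 2) <= mean u v f ^+ 2 + e ^+ 2.

Lemma mean_indic_open (R : realType) (U : set R) (a b : R) : open U ->
  [/\ loc_int (\1_U : R -> R),
    a < b -> (((b - a) * mean a b \1_U)%:E <= leb U)%E,
    (forall u v : R, u < v -> 0 <= mean u v \1_U) &
    (forall u v : R, u < v -> (forall y, u <= y <= v -> U y) ->
      mean u v \1_U = 1)].
Proof.
move=> oU; have mU := open_measurable oU.
have lU : loc_int (\1_U : R -> R) by exact: locally_integrable_indic openT mU.
split => //.
- move=> ab; rewrite /mean mulVKf; last by rewrite gt_eqF ?subr_gt0.
  rewrite /Rintegral fineK; last by apply: integrable_fin_num => //; exact: loc_int_itv.
  rewrite integral_indic//; apply: le_measure => //; rewrite ?inE//.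
  exact: measurableI.
- by move=> u v uv; exact: mean_ge0.
- move=> u v uv uvU; rewrite /mean.
  rewrite (@eq_Rintegral _ _ R leb _ (fun=> 1)).
    rewrite Rintegral_cst//= lebesgue_measure_itv /= lte_fin uv /= mul1r mulVf//.
    by rewrite gt_eqF ?subr_gt0.
  by move=> y; rewrite inE /= in_itv /= => /uvU Uy; rewrite indicE mem_set.
Qed.

Lemma bellman_induction (R : realType) (h f : R -> R) (d e a b : R) :
  gauge h -> 0 < e -> e < d -> a < b ->
  loc_int f -> loc_int (fun x => f x ^+ 2) -> bmo_le f a b e ->
  `|mean a b f| <= d ->
  h (2 * d) / (4 * d ^+ 2) * mean a b (fun x => f x ^+ 2) <=
  mean a b (fun x => h `|f x|).
Proof.
move=> gh e0 ed ab lf lf2 fe fd.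
have lh := gauge_loc_int gh lf.
have d0 : 0 < d by lra.
have c0 : 0 <= h (2 * d) / (4 * d ^+ 2).
  apply: divr_ge0; first by apply: (gauge_ge0 gh); lra.
  by apply: mulr_ge0 => //; exact: sqr_ge0.
set c := _ / _ in c0 *.
(* The primitives start at [a - 1] because their continuity and derivatives are available only
   beyond the base point, while [x = a] must be covered. *)
have ale s : a <= s -> a - 1 <= s by lra.
have sl g s t : loc_int g -> a <= s -> s < t -> slope (prim (a - 1) g) s t = mean s t g.
  by move=> lg as_ st; apply: slope_prim => //; exact: ale.
rewrite -(sl _ _ _ lf2 (lexx _) ab) -(sl _ _ _ lh (lexx _) ab).
apply: (@stopping_time R (prim (a - 1) f) (prim (a - 1) (fun x => f x ^+ 2))
  (prim (a - 1) (fun x => h `|f x|)) a b d e c) => //.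
- by move=> x /andP[ax xb]; split; apply: prim_continuous => //; lra.
- move=> u v au uv vb; rewrite !sl//; apply/andP; split; first exact: mean_sqr_ge.
  exact: fe.
- by move=> u v au uv vb; rewrite !sl//; exact: stopped_bound.
- move=> u v au uv vb; rewrite !sl//; apply: mean_ge0 => // x.
  exact/(gauge_ge0 gh)/normr_ge0.
- move=> eta eta0; have [U [oU Ueta UP]] := exceptional_open_set ab lf lf2 eta0.
  have [lU Uab U0 U1] := mean_indic_open a b oU.
  exists (prim (a - 1) \1_U); split.
  + have -> : prim (a - 1) \1_U b - prim (a - 1) \1_U a = (b - a) * mean a b \1_U.
      by rewrite -(sl _ _ _ lU (lexx _) ab) /slope mulrC divfK// gt_eqF ?subr_gt0.
    by rewrite -lte_fin; apply: le_lt_trans (Uab ab) Ueta.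
  + by move=> u v au uv vb; rewrite sl//; exact: U0.
  + move=> x xab; have [Ux|xP] := UP x xab.
      left; have /nbhs_ballP[r /= r0 rU] := open_nbhs_nbhs (conj oU Ux).
      exists r => // u v /andP[au ux] /andP[xv vb] uv uvr; rewrite sl//.
      apply: U1 => // y /andP[uy yv]; apply: rU; rewrite /ball /= ltr_norml.
      by apply/andP; split; lra.
    right; exists (f x) => k k0; have [r r0 rP] := xP k k0; exists r => //.
    by move=> u v /andP[au ux] /andP[xv vb] uv uvr; rewrite !sl//; exact: rP.
- by rewrite sl.
Qed.

Lemma bmo_lower (R : realType) (h f : R -> R) (d e a b : R) :
  gauge h -> 0 < e -> e < d -> a < b ->
  loc_int f -> loc_int (fun x => f x ^+ 2) -> bmo_le f a b e ->
  h (2 * d) / (4 * d ^+ 2) * (mean a b (fun x => f x ^+ 2) - mean a b f ^+ 2) <=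
  mean a b (fun x => h `|f x|).
Proof.
move=> gh e0 ed ab lf lf2 fe; have lh := gauge_loc_int gh lf.
have d0 : 0 < d by lra.
have h2d : 0 <= h (2 * d) by apply: (gauge_ge0 gh); lra.
have c0 : 0 <= h (2 * d) / (4 * d ^+ 2).
  by apply: divr_ge0 => //; apply: mulr_ge0 => //; exact: sqr_ge0.
have [fd|df] := leP `|mean a b f| d.
  apply: le_trans (bellman_induction gh e0 ed ab lf lf2 fe fd).
  by apply: ler_wpM2l => //; have := sqr_ge0 (mean a b f); lra.
have := fe a b (lexx _) ab (lexx _).
set X1 := mean a b f in df *; set X2 := mean a b _; set H := mean a b _ => X12.
(* For a mean of size [T > d], [x2 <= T^2 + d^2 <= 2 T^2]. Averaging the parabola over [f] or [- f]
   then gives [<h(|f|)> >= h(T) / 2 >= h(d) / 2 >= h(2d) / 4 = c d^2], and [c d^2] dominates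
   [c (x2 - x1^2)]. *)
have [T TE] : exists T, T = `|X1| by eexists.
have T0 : 0 < T by lra.
have XT : X1 ^+ 2 = T ^+ 2 by rewrite TE real_normK ?num_real.
have [p pE] : exists p, p = h T / T by eexists.
have b1 : p * X1 + - (p / (4 * T)) * X2 + 0 <= H.
  apply: mean_quadratic_le => // x _; apply: le_trans (gauge_parabola (f x) gh T0).
  by rewrite pE; set y := h T / T; rewrite le_eqVlt; apply/orP; left; apply/eqP;
    field; lra.
have b2 : - p * X1 + - (p / (4 * T)) * X2 + 0 <= H.
  apply: mean_quadratic_le => // x _; rewrite -(normrN (f x));
    apply: le_trans (gauge_parabola (- f x) gh T0).
  by rewrite pE; set y := h T / T; rewrite le_eqVlt; apply/orP; left; apply/eqP;
    field; lra.
have b3 : p * T - p / (4 * T) * X2 <= H.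
  have [x0|x0] := leP 0 X1.
    by move: TE b1; rewrite ger0_norm// => <-; lra.
  have X1T : - X1 = T by rewrite TE ltr0_norm.
  by rewrite mulNr -mulrN X1T in b2; lra.
have p0 : 0 <= p by rewrite pE; apply: divr_ge0; [apply: (gauge_ge0 gh)|]; lra.
have e2d : e ^+ 2 <= d ^+ 2 by rewrite ler_sqr ?nnegrE; lra.
have d2T : d ^+ 2 <= T ^+ 2 by rewrite ler_sqr ?nnegrE; lra.
have hT2 : h T / 2 <= H.
  apply: le_trans b3.
  have : p / (4 * T) * X2 <= p / (4 * T) * (2 * T ^+ 2).
    by rewrite ler_wpM2l//; [apply: divr_ge0; lra|lra].
  have -> : p / (4 * T) * (2 * T ^+ 2) = p * T / 2 by field; lra.
  have -> : p * T = h T by rewrite pE divfK// gt_eqF.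
  by lra.
have : h (2 * d) / (4 * d ^+ 2) * (X2 - X1 ^+ 2) <= h (2 * d) / (4 * d ^+ 2) * d ^+ 2.
  by apply: ler_wpM2l => //; lra.
have -> : h (2 * d) / (4 * d ^+ 2) * d ^+ 2 = h (2 * d) / 4 by field; lra.
have hd : d * h (2 * d) <= 2 * d * h d by apply: gauge_chord => //; lra.
have {}hd : h (2 * d) <= 2 * h d by rewrite -(ler_pM2l d0); lra.
have : h d <= h T by apply: gauge_le => //; lra.
by lra.
Qed.

(** * From the completed Lebesgue measure to Borel functions *)

(** The line with the Caratheodory measurable sets, the domain of the completed measure. The name
    serves to tell this sigma-algebra from the Borel one, since both are put on the same sets of
    reals. *)
Definition lebesgueTypeR (R : realType) :=
  caratheodory_type ((@wlength R idfun)^*)%mu.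

Section transfer.
Context {R : realType}.
Notation bT := (measurableTypeR R).
Notation cT := (lebesgueTypeR R).

Lemma borel_lebesgue_measurable (A : set R) :
  measurable (A : set bT) -> measurable (A : set cT).
Proof. exact: sub_caratheodory. Qed.

Lemma lebesgue_measurable_decomp (E : set R) : measurable (E : set cT) ->
  exists A N : set R, [/\ measurable (A : set bT), measurable (N : set bT),
    leb N = 0, A `<=` E & E `<=` A `|` N].
Proof.
rewrite [X in X -> _](_ : _ = (completed_algebra_gen (@lebesgue_measure
  R)).-sigma.-measurable E); last first.
  by rewrite completed_caratheodory_measurable.
rewrite g_sigma_completed_algebra_genE => -[A mA [N0 [N [mN N00 N0N]]] <-].
by exists A, N; split => //; apply: setUS.
Qed.

Lemma measurable_id_lebesgue : measurable_fun [set: cT] (id : cT -> bT).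
Proof. by move=> _ A mA; rewrite setTI; exact: borel_lebesgue_measurable. Qed.

Lemma measurable_borel_comp d (T : measurableType d) (D : set R) (f : R -> T) :
  measurable (D : set bT) -> measurable_fun (D : set bT) f ->
  measurable_fun (D : set cT) f.
Proof.
by move=> mD mf _ A mA; apply: borel_lebesgue_measurable; exact: mf.
Qed.

(** A change of variables along the identity, which is measurable from Lebesgue to Borel sets and
    pushes the completed measure forward to [leb]. *)
Lemma ge0_integral_completed (D : set R) (f : R -> \bar R) :
  measurable (D : set bT) -> measurable_fun (D : set bT) f ->
  (forall x, 0 <= f x)%E ->
  (\int[clm]_(x in D) f x = \int[leb]_(x in D) f x)%E.
Proof.
move=> mD mf f0.
have := @ge0_integral_pushforward _ _ cT bT R id measurable_id_lebesgue clm D f mD mf.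
move=> /(_ (fun x _ => f0 x)) /= <-.
apply: eq_measure_integral; first exact: measurable_id_lebesgue.
by [].
Qed.

Lemma integral_completed (D : set R) (f : R -> \bar R) :
  measurable (D : set bT) -> measurable_fun (D : set bT) f ->
  (\int[clm]_(x in D) f x = \int[leb]_(x in D) f x)%E.
Proof.
move=> mD mf; rewrite integralE [RHS]integralE.
congr (_ - _)%E.
- by apply: ge0_integral_completed => //; exact: measurable_funepos.
- by apply: ge0_integral_completed => //; exact: measurable_funeneg.
Qed.


(** Each set [f > q] with [q] rational is Borel up to a null set. Countably many of them determine
    [f], so the union [M] of these null sets is null, and [f] becomes Borel once it is set to 0 on
    [M] and outside [D]. *)
Lemma borel_representative (D : set R) (f : R -> R) :
  measurable (D : set bT) -> measurable_fun (D : set cT) f ->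
  exists (g : R -> R) (M : set R), [/\ measurable_fun [set: bT] g,
    measurable (M : set bT), leb M = 0,
    forall x, D x -> ~ M x -> g x = f x & forall x, ~ D x -> g x = 0].
Proof.
move=> mD mf; have mDc := borel_lebesgue_measurable mD.
have dec (q : rat) : exists AN : set R * set R,
    [/\ measurable (AN.1 : set bT), measurable (AN.2 : set bT), leb AN.2 = 0,
      AN.1 `<=` D `&` f @^-1` `]ratr q, +oo[ &
      D `&` f @^-1` `]ratr q, +oo[ `<=` AN.1 `|` AN.2].
  have [A [N [mA mN N0 AE EAN]]] := lebesgue_measurable_decomp (mf mDc `]ratr q,
    +oo[%classic (measurable_itv _)).
  by exists (A, N).
pose A q := (sval (cid (dec q))).1; pose N q := (sval (cid (dec q))).2.
have AN q : [/\ measurable (A q : set bT), measurable (N q : set bT), leb (N q) = 0,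
      A q `<=` D `&` f @^-1` `]ratr q, +oo[ &
      D `&` f @^-1` `]ratr q, +oo[ `<=` A q `|` N q] by exact: (svalP (cid (dec q))).
pose M := \bigcup_q N q.
have mM : measurable (M : set bT).
  by apply: bigcupT_measurable_rat => q; have [] := AN q.
have M0 : leb M = 0.
  have [code [decode codeK]] : exists (code : rat -> nat) decode, pcancel code decode.
    by exists pickle, unpickle; exact: pickleK.
  apply/negligibleP => //.
  have -> : M = \bigcup_n (if decode n is Some q then N q else set0).
    apply/seteqP; split => [x [q _ Nx]|x [n _]].
      by exists (code q) => //; rewrite codeK.
    by case: (decode n) => // q Nx; exists q.
  apply: negligible_bigcup => n; case: (decode n) => [q|]; last exact: negligible_set0.
  by have [_ mN N0 _ _] := AN q; apply/negligibleP.
pose g x := if x \in D `\` M then f x else 0.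
exists g, M; split => //.
- move=> _; apply: (measurability _ (RGenOInfty.measurableE R)) => //.
  move=> /= _ [_ [r ->] <-]; rewrite setTI preimage_itvoy.
  (* On [D] without [M], [g > r] holds when [f > q] for some rational [q >= r]. Elsewhere [g = 0],
     and [r < 0] is witnessed by a rational [q] with [r <= q < 0]. *)
  rewrite [X in measurable X](_ : _ = \bigcup_(q in [set q : rat | r <= ratr q])
    ((A q `\` M) `|` (if (ratr q < 0 :> R) then ~` (D `\` M) else set0))); last first.
    apply/seteqP; split => x /=.
      rewrite /g; case: ifPn; rewrite ?inE.
        move=> [Dx nMx] /rat_in_itvoo [q]; rewrite in_itv /= => /andP[rq qf].
        exists q; first exact: ltW; left; split => //.
        have [_ _ _ _ EAN] := AN q.
        have [|//|Nx] := EAN x; first by split => //=; rewrite in_itv /= qf.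
        by exfalso; apply: nMx; exists q.
      rewrite notin_setE => nDM /rat_in_itvoo [q]; rewrite in_itv /= => /andP[rq q0].
      by exists q; [exact: ltW|right; rewrite q0].
    move=> [q /= rq []].
      move=> [Ax nMx]; have [_ _ _ AE _] := AN q; have [Dx] := AE x Ax.
      rewrite /= in_itv /= andbT => qf.
      rewrite /g ifT; first exact: le_lt_trans qf.
      by rewrite inE.
    case: ifP => // q0 nDM; rewrite /g ifF; first exact: le_lt_trans q0.
    by apply/negbTE; rewrite notin_setE.
  rewrite bigcup_mkcond; apply: bigcupT_measurable_rat => q; case: ifP => // _.
  have [mA _ _ _ _] := AN q.
  apply: measurableU; first exact: measurableD.
  by case: ifP => // _; apply: measurableC; exact: measurableD.
- by move=> x Dx nMx; rewrite /g ifT// inE.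
- move=> x nDx; rewrite /g ifF//; apply/negbTE; rewrite notin_setE.
  by move=> [].
Qed.

End transfer.

(** * Subintervals and Borel functions with the same averages *)

Lemma subset_itv_closure (R : realType) (p q : bool) (a b : R) :
  [set` Interval (BSide p a) (BSide q b)] `<=` `[a, b].
Proof.
move=> x; rewrite /= in_itv /= itv_boundlr.
by case: p; case: q; rewrite !bnd_simp => /andP[*]; apply/andP; split => //;
  exact: ltW.
Qed.

Lemma subinterval_ends (R : realType) (J : set R) (p q : bool) (a b : R) :
  subinterval J [set` Interval (BSide p a) (BSide q b)] ->
  exists p' q' s t, [/\ a <= s, s < t, t <= b &
    J = [set` Interval (BSide p' s) (BSide q' t)]].
Proof.
move=> [[p' [q' [s [t [st ->]]]]] JQ]; exists p', q', s, t.
have inside x : s < x -> x < t -> a <= x <= b.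
  move=> sx xt.
  have /JQ/subset_itv_closure : [set` Interval (BSide p' s) (BSide q' t)] x.
    rewrite /= itv_boundlr.
    by case: p' {JQ}; case: q'; rewrite !bnd_simp /= ?(ltW sx) ?(ltW xt) ?sx ?xt.
  by rewrite /= in_itv.
split => //.
- rewrite leNgt; apply/negP => sa; pose m := Num.min a t.
  have sm : s < m by rewrite lt_min sa.
  have [x0 x1] : s < (s + m) / 2 /\ (s + m) / 2 < m by split; lra.
  have mt : m <= t by rewrite ge_min lexx orbT.
  have ma : m <= a by rewrite ge_min lexx.
  have /andP[] := inside ((s + m) / 2) x0 (lt_le_trans x1 mt); lra.
- rewrite leNgt; apply/negP => bt; pose m := Num.max b s.
  have sm : m < t by rewrite gt_max bt.
  have [x0 x1] : m < (m + t) / 2 /\ (m + t) / 2 < t by split; lra.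
  have mt : s <= m by rewrite le_max lexx orbT.
  have ma : b <= m by rewrite le_max lexx.
  have /andP[] := inside ((m + t) / 2) (le_lt_trans mt x0) x1; lra.
Qed.

Lemma subinterval_open (R : realType) (p q : bool) (a b s t : R) :
  a <= s -> s < t -> t <= b ->
  subinterval `]s, t[%classic [set` Interval (BSide p a) (BSide q b)].
Proof.
move=> as_ st tb; split; first by exists false, true, s, t.
move=> x; rewrite /= in_itv /= itv_boundlr => /andP[sx xt].
have ax := le_lt_trans as_ sx; have xb := lt_le_trans xt tb.
by case: p; case: q; rewrite !bnd_simp /= ?(ltW ax) ?(ltW xb) ?ax ?xb.
Qed.

Lemma integral_itv_closure (R : realType) (p q : bool) (s t : R) (f : R -> \bar R) :
  measurable_fun setT f ->
  (\int[leb]_(x in [set` Interval (BSide p s) (BSide q t)]) f x =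
   \int[leb]_(x in `[s, t]) f x)%E.
Proof.
move=> mf; have mfD D : measurable_fun D f by exact: measurable_funTS.
case: q; first by case: p; rewrite integral_itv_bndo_bndc// ?integral_itv_obnd_cbnd.
by case: p; rewrite // integral_itv_obnd_cbnd.
Qed.

Lemma completed_lebesgue_itv (R : realType) (p q : bool) (s t : R) : s < t ->
  clm [set` Interval (BSide p s) (BSide q t)] = (t - s)%:E.
Proof.
move=> st; have := @lebesgue_measure_itv R (Interval (BSide p s) (BSide q t)).
by rewrite /= lte_fin st.
Qed.

(** The equality is one of extended reals and holds for every Borel [u], so it transfers finiteness
    as well as values. It is used with [u] the identity, a square, and [h |y - c|]; integrals over
    all kinds of intervals reduce to closed segments. *)
Definition represents (R : realType) (Q : set R) (f g : R -> R) : Prop :=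
  loc_int g /\
  forall (u : R -> R) (p q : bool) (s t : R), measurable_fun setT u ->
    s < t -> [set` Interval (BSide p s) (BSide q t)] `<=` Q ->
    eavg [set` Interval (BSide p s) (BSide q t)] (u \o f) =
    (((t - s)^-1)%:E * \int[leb]_(x in `[s, t]) (u (g x))%:E)%E.

Lemma represented (R : realType) (Q : set R) (f : R -> R) : bounded_itv Q ->
  integrable_on Q f -> exists2 g, represents Q f g & forall x, ~ Q x -> g x = 0.
Proof.
move=> [p [q [a [b [ab QE]]]]] fQ.
have mQ : measurable (Q : set (measurableTypeR R)) by rewrite QE; exact: measurable_itv.
have mf : measurable_fun (Q : set (lebesgueTypeR R)) f.
  by apply/measurable_EFinP; exact: (measurable_int _ fQ).
have [g [M [mg mM M0 gf g0]]] := borel_representative mQ mf.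
have eq_int (D : set R) (u : R -> R) : measurable (D : set (measurableTypeR R)) ->
  D `<=` Q ->
    measurable_fun setT u ->
    (\int[clm]_(x in D) (u (f x))%:E = \int[leb]_(x in D) (u (g x))%:E)%E.
  move=> mD DQ mu_.
  have mug : measurable_fun (D : set (measurableTypeR R)) (fun x => (u (g x))%:E).
    apply/measurable_EFinP/measurable_funTS.
    exact: (measurableT_comp mu_ mg).
  rewrite -integral_completed//.
  have mDc := borel_lebesgue_measurable mD.
  have mugc := measurable_borel_comp mD mug.
  have mufc : measurable_fun (D : set (lebesgueTypeR R)) (fun x => (u (f x))%:E).
    have mu_E : measurable_fun setT (fun y : R => (u y)%:E) by exact/measurable_EFinP.
    exact: (measurableT_comp mu_E (measurable_funS (borel_lebesgue_measurable mQ)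
      DQ mf)).
  apply: (@ae_eq_integral _ (lebesgueTypeR R) R clm D _ _ mDc mufc mugc).
  exists M; split => //; first exact: borel_lebesgue_measurable.
  move=> x /= /not_implyP[Dx ne]; apply: contrapT => nM; apply: ne.
  by rewrite gf//; exact: DQ.
exists g => //; split.
  have gE : g = g \_ Q.
    by apply/funext => x; rewrite patchE; case: ifPn => //; rewrite notin_setE => /g0.
  rewrite gE; apply: integrable_locally => //.
  apply/integrableP; split; first exact/measurable_EFinP/measurable_funTS.
  have := eq_int Q (fun x => `|x|) mQ (@subset_refl _ _) (@normr_measurable R setT).
  by move=> /= <-; have /integrableP[_] := fQ.
move=> u p' q' s t mu_ st JQ; rewrite /eavg.
have mJ : measurable ([set` Interval (BSide p' s) (BSide q' t)] : set
  (measurableTypeR R)).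
  exact: measurable_itv.
rewrite completed_lebesgue_itv// inver subr_eq0 gt_eqF// eq_int//
  integral_itv_closure//.
by apply/measurable_EFinP; exact: (measurableT_comp mu_ mg).
Qed.

Lemma represents_self (R : realType) (Q : set R) (f : R -> R) : loc_int f ->
  represents Q f f.
Proof.
move=> lf; have [mf _ _] := lf; split => // u p q s t mu_ st JQ; rewrite /eavg.
have mJ : measurable ([set` Interval (BSide p s) (BSide q t)] : set
  (measurableTypeR R)).
  exact: measurable_itv.
have muf : measurable_fun setT (fun x : R => (u (f x))%:E).
  by apply/measurable_EFinP; exact: (measurableT_comp mu_ mf).
rewrite completed_lebesgue_itv// inver subr_eq0 gt_eqF// integral_completed//;
  last exact: measurable_funTS.
by rewrite integral_itv_closure.
Qed.

(** * Truncations *)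

Definition trunc (R : realType) (N x : R) : R := Num.max (- N) (Num.min N x).

Lemma trunc_id (R : realType) (N x : R) : `|x| <= N -> trunc N x = x.
Proof.
rewrite ler_norml => /andP[Nx xN].
by rewrite /trunc (min_idPr xN) (max_idPr Nx).
Qed.

Lemma trunc_lip (R : realType) (N x y : R) : `|trunc N x - trunc N y| <= `|x - y|.
Proof.
wlog xy : x y / x <= y.
  by move=> wlg; have [/wlg//|/ltW/wlg] := leP x y; rewrite distrC (distrC y).
have le_tr : trunc N x <= trunc N y.
  rewrite /trunc ge_max !le_max lexx /=; apply/orP; right.
  by rewrite le_min !ge_min lexx xy orbT.
have tr_le : trunc N y <= trunc N x + (y - x).
  rewrite [in leLHS]/trunc ge_max; apply/andP; split.
    have : - N <= trunc N x by rewrite le_max lexx.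
    by lra.
  have : Num.min N x <= trunc N x by rewrite le_max lexx orbT.
  have : Num.min N y <= Num.min N x + (y - x).
    by have [Nx|xN] := leP N x; rewrite ge_min; apply/orP; [left|right]; lra.
  by lra.
by rewrite !ler0_norm; lra.
Qed.

Lemma normr_trunc (R : realType) (N x : R) : 0 <= N ->
  `|trunc N x| = Num.min N `|x|.
Proof.
move=> N0; rewrite /trunc; have [x0|x0] := leP 0 x.
  have m0 : 0 <= Num.min N x by rewrite le_min N0.
  by rewrite (@max_idPr _ _ (- N) _ _) ?ger0_norm//; lra.
rewrite (@min_idPr _ _ N x _); last lra.
rewrite (ltr0_norm x0) ler0_norm; last by rewrite ge_max; apply/andP; split; lra.
by rewrite oppr_max opprK.
Qed.

Lemma measurable_trunc (R : realType) (N : R) : measurable_fun setT (@trunc R N).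
Proof. by apply: measurable_maxr => //; apply: measurable_minr. Qed.

Lemma mean_dominated_cvg (R : realType) (f_ : nat -> R -> R) (f g : R -> R) (s t : R) :
  s < t -> (forall n, measurable_fun setT (f_ n)) -> measurable_fun setT f ->
  loc_int g -> (forall n x, `|f_ n x| <= `|g x|) ->
  (forall x, f_ n x @[n --> \oo] --> f x) ->
  mean s t (f_ n) @[n --> \oo] --> mean s t f.
Proof.
move=> st mf_ mf lg fg fcvg.
have lf_ n : loc_int (f_ n) by exact: (loc_int_le (mf_ n) lg (fg n)).
have fgl x : `|f x| <= `|g x|.
  have cn : `|f_ n x| @[n --> \oo] --> `|f x| by apply: cvg_norm.
  apply: (@cvgr_to_le nat \oo _ R _ _ _ cn); apply: nearW => n; exact: fg.
have lf : loc_int f by exact: (loc_int_le mf lg fgl).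
apply: cvgM; first exact: cvg_cst.
apply: fine_cvg; rewrite fineK; last by apply: integrable_fin_num => //;
  exact: loc_int_itv.
have [] := @dominated_convergence _ _ R leb `[s, t] (measurable_itv _) (fun n =>
  EFin \o f_ n) (EFin \o f) (EFin \o (fun x => `|g x|)).
- by move=> n; apply/measurable_EFinP/measurable_funTS; exact: mf_.
- exact/measurable_EFinP/measurable_funTS.
- by apply: aeW => x _; apply: cvg_EFin; [exact: nearW|exact: fcvg].
- have lng : loc_int (fun x => `|g x|).
    have [mg _ _] := lg.
    by apply: (loc_int_le _ lg) => [|x]; [exact: measurableT_comp|rewrite normr_id].
  exact: loc_int_itv.
- by apply: aeW => x n _ /=; rewrite lee_fin.
by move=> _ _.
Qed.

(** The squares of the truncations increase to [g^2], so monotone convergence applies before [g^2]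
    is known to be integrable. *)
Lemma trunc_sqr_integral_bound (R : realType) (g : R -> R) (a b C : R) :
  measurable_fun setT g ->
  (forall n : nat, (\int[leb]_(x in `[a, b]) (trunc n%:R (g x) ^+ 2)%:E <= C%:E)%E) ->
  (\int[leb]_(x in `[a, b]) (g x ^+ 2)%:E <= C%:E)%E.
Proof.
move=> mg gC.
have sq_nd x (n m : nat) : (n <= m)%N -> trunc n%:R (g x) ^+ 2 <= trunc m%:R (g x) ^+ 2.
  move=> nm; rewrite -(real_normK (num_real (trunc n%:R _))) -(real_normK (num_real
    (trunc m%:R _))).
  rewrite ler_sqr ?nnegrE// !normr_trunc//.
  by rewrite le_min !ge_min lexx orbT andbT ler_nat nm.
have cvg_tr x : (trunc n%:R (g x) ^+ 2)%:E @[n --> \oo] --> (g x ^+ 2)%:E.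
  apply: cvg_near_cst; have [N _ NP] := nbhs_infty_ger `|g x|.
  exists N => [//|n Nn] /=; rewrite trunc_id//; exact: NP.
have mtr n : measurable_fun setT (fun x => trunc n%:R (g x) ^+ 2).
  apply: (@measurable_funX _ _ R setT (fun x => trunc n%:R (g x)) 2).
  exact: (measurableT_comp (measurable_trunc n%:R) mg).
have H : (\int[leb]_(x in `[a, b]) (trunc n%:R (g x) ^+ 2)%:E @[n --> \oo] -->
    \int[leb]_(x in `[a, b]) limn (fun n => (trunc n%:R (g x) ^+ 2)%:E))%E.
  apply: cvg_monotone_convergence; first exact: measurable_itv.
  - by move=> n; apply/measurable_EFinP/measurable_funTS; exact: mtr.
  - by move=> n x _; rewrite lee_fin sqr_ge0.
  - by move=> x _ n m nm; rewrite lee_fin; exact: sq_nd.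
have -> : (\int[leb]_(x in `[a, b]) (g x ^+ 2)%:E =
    \int[leb]_(x in `[a, b]) limn (fun n => (trunc n%:R (g x) ^+ 2)%:E))%E.
  by apply: eq_integral => x _; apply/esym/cvg_lim => //; exact: cvg_tr.
exact: (@cvge_to_le nat \oo _ R _ C%:E _ H (nearW _ gC)).
Qed.

Lemma loc_int_shift (R : realType) (f : R -> R) (c : R) :
  loc_int f -> loc_int (fun x => f x - c).
Proof. by move=> lf; exact: loc_intD lf (loc_int_cst (- c)). Qed.

Lemma loc_int_sqr_shift (R : realType) (f : R -> R) (c : R) :
  loc_int f -> loc_int (fun x => f x ^+ 2) -> loc_int (fun x => (f x - c) ^+ 2).
Proof.
move=> lf lf2.
have -> : (fun x => (f x - c) ^+ 2) = (fun x =>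
  (f x ^+ 2 + (- (2 * c)) * f x) + c ^+ 2).
  by apply/funext => x; ring.
by apply: loc_intD; [apply: loc_intD lf2 _; exact: loc_intZ|exact: loc_int_cst].
Qed.

Lemma mean_shift (R : realType) (f : R -> R) (c s t : R) : s < t -> loc_int f ->
  mean s t (fun x => f x - c) = mean s t f - c.
Proof.
move=> st lf; have := mean_lin3 1 0 (- c) st lf lf; rewrite mul1r mul0r addr0 => <-.
by congr mean; apply/funext => x; ring.
Qed.

Lemma mean_sqr_shift (R : realType) (f : R -> R) (c s t : R) : s < t ->
  loc_int f -> loc_int (fun x => f x ^+ 2) ->
  mean s t (fun x => (f x - c) ^+ 2) =
  mean s t (fun x => f x ^+ 2) - 2 * c * mean s t f + c ^+ 2.
Proof.
move=> st lf lf2; rewrite -mulNr -[X in X + _ + _]mul1r -mean_lin3//.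
by congr mean; apply/funext => x; ring.
Qed.

Lemma osc_lower (R : realType) (h f : R -> R) (d e a b s t c : R) :
  gauge h -> 0 < e -> e < d -> a <= s -> s < t -> t <= b ->
  loc_int f -> loc_int (fun x => f x ^+ 2) -> bmo_le f a b e ->
  h (2 * d) / (4 * d ^+ 2) * (mean s t (fun x => f x ^+ 2) - mean s t f ^+ 2) <=
  mean s t (fun x => h `|f x - c|).
Proof.
move=> gh e0 ed as_ st tb lf lf2 fe.
have -> : mean s t (fun x => f x ^+ 2) - mean s t f ^+ 2 =
    mean s t (fun x => (f x - c) ^+ 2) - mean s t (fun x => f x - c) ^+ 2.
  by rewrite mean_shift// mean_sqr_shift//; ring.
apply: (@bmo_lower R h (fun x => f x - c) d e s t gh e0 ed st).
- exact: loc_int_shift.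
- exact: loc_int_sqr_shift.
- move=> u v su uv vt; rewrite mean_shift// mean_sqr_shift//.
  have := fe u v (le_trans as_ su) uv (le_trans vt tb); lra.
Qed.

(* For the truncations the variances are bounded, with supremum V say; applying
   osc_lower with e = sqrt V and d = 2 e gives h (4 e) <= 16 K. *)
Lemma trunc_variance_bound (R : realType) (h f : R -> R) (a b K M : R) :
  gauge h -> a < b -> 0 < M -> 16 * K < h (4 * M) ->
  loc_int f -> loc_int (fun x => f x ^+ 2) ->
  (exists N, forall s t, a <= s -> s < t -> t <= b ->
    mean s t (fun x => f x ^+ 2) - mean s t f ^+ 2 <= N) ->
  (forall s t, a <= s -> s < t -> t <= b ->
    exists c, mean s t (fun x => h `|f x - c|) <= K) ->
  bmo_le f a b M.
Proof.
move=> gh ab M0 hM lf lf2 [N fN] fK.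
pose S := [set mean st.1 st.2 (fun x => f x ^+ 2) - mean st.1 st.2 f ^+ 2 |
  st in [set st : R * R | [/\ a <= st.1, st.1 < st.2 & st.2 <= b]]].
have S0 : S !=set0 by exists (mean a b (fun x => f x ^+ 2) - mean a b f ^+ 2), (a, b).
have SN : ubound S N by move=> _ [[s t] [/= as_ st tb] <-]; exact: fN.
pose V := sup S.
have SV s t : a <= s -> s < t -> t <= b -> mean s t (fun x =>
  f x ^+ 2) - mean s t f ^+ 2 <= V.
  by move=> as_ st tb; apply: ub_le_sup; [exists N|exists (s, t)].
have [VM|MV] := leP V (M ^+ 2).
  by move=> u v au uv vb; have := SV u v au uv vb; lra.
have V0 : 0 < V by apply: lt_trans MV; exact: exprn_gt0.
pose e := Num.sqrt V; have e0 : 0 < e by rewrite sqrtr_gt0.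
have eV : e ^+ 2 = V by rewrite sqr_sqrtr// ltW.
have Me : M < e by rewrite -(@ltr_pXn2r _ 2)// ?nnegrE ?eV// ltW.
have fe : bmo_le f a b e by move=> u v au uv vb; rewrite eV;
  have := SV u v au uv vb; lra.
have e2 : e < 2 * e by lra.
have hlt : h (4 * M) < h (4 * e) by apply: gauge_lt => //; lra.
have h0 : 0 < h (4 * e) by apply: gauge_gt0 => //; lra.
have : V <= 16 * V * K / h (4 * e).
  apply: ge_sup => // _ [[s t] [/= as_ st tb] <-].
  have [c fc] := fK s t as_ st tb.
  have := osc_lower c gh e0 e2 as_ st tb lf lf2 fe; set w := _ - _ => wK.
  rewrite ler_pdivlMr//.
  have {}wK := le_trans wK fc.
  have -> : w * h (4 * e) = 16 * e ^+ 2 * (h (2 * (2 * e)) / (4 * (2 * e) ^+ 2) * w).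
    have -> : 2 * (2 * e) = 4 * e by ring.
    by field; lra.
  by rewrite -eV ler_pM2l//; apply: mulr_gt0 => //; exact: exprn_gt0.
rewrite ler_pdivlMr// => Vh.
have : V * (16 * K) < V * h (4 * e) by rewrite ltr_pM2l//; lra.
by lra.
Qed.

Lemma osc_bmo (R : realType) (h g : R -> R) (a b K : R) :
  gauge h -> a < b -> 0 <= K -> loc_int g -> (forall x, ~ (a <= x <= b) -> g x = 0) ->
  (forall s t, a <= s -> s < t -> t <= b ->
    mean s t (fun x => h `|g x - mean s t g|) <= K) ->
  loc_int (fun x => g x ^+ 2) /\ exists2 M, 0 < M & bmo_le g a b M.
Proof.
move=> gh ab K0 lg g0 gK; have [mg _ _] := lg.
(* The added 1 makes [T] positive and [16 K < h (4 M)] strict for [M = T / 4], a bound that is the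
   same for all truncations. *)
have [|T T0 hT] := gauge_surj gh (_ : 0 <= 16 * K + 1); first by lra.
have Tn0 : T != 0 by apply/eqP => TE; move: hT; rewrite TE (gauge0 gh); lra.
have {}T0 : 0 < T by rewrite lt_neqAle eq_sym Tn0.
pose M := T / 4; have M0 : 0 < M by rewrite /M; lra.
have hM : 16 * K < h (4 * M) by rewrite /M (_ : 4 * (T / 4) = T) ?hT; [lra|field].
pose f_ (n : nat) x := trunc n%:R (g x).
have mf n : measurable_fun setT (f_ n)
  by exact: (measurableT_comp (measurable_trunc n%:R) mg).
have fg n x : `|f_ n x| <= `|g x| by rewrite normr_trunc// ge_min lexx orbT.
have fn n x : `|f_ n x| <= n%:R by rewrite normr_trunc// ge_min lexx.
have lf n : loc_int (f_ n) by exact: (loc_int_le (mf n) lg (fg n)).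
have mf2 n : measurable_fun setT (fun x =>
  f_ n x ^+ 2) by exact: (@measurable_funX _ _ R setT (f_ n) 2).
have fn2 n x : f_ n x ^+ 2 <= n%:R ^+ 2.
  by rewrite -(real_normK (num_real (f_ n x))) ler_sqr ?nnegrE.
have lf2 n : loc_int (fun x => f_ n x ^+ 2).
  apply: (loc_int_le (mf2 n) (loc_int_cst (n%:R ^+ 2))) => x.
  by rewrite !ger0_norm ?sqr_ge0.
have fM n : bmo_le (f_ n) a b M.
  apply: (@trunc_variance_bound R h (f_ n) a b K M) => //.
    exists (n%:R ^+ 2) => s t as_ st tb.
    have : mean s t (fun x => f_ n x ^+ 2) <= mean s t (fun=> n%:R ^+ 2).
      by apply: mean_le => //; exact: loc_int_cst.
    have -> : mean s t (fun=> n%:R ^+ 2) = n%:R ^+ 2 :> R.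
      have := @mean_lin3 R 0 0 (n%:R ^+ 2) _ _ s t st lg lg.
      rewrite !mul0r !add0r => E; rewrite -[RHS]E; congr mean.
      by apply/funext => x; rewrite !mul0r !add0r.
    have := sqr_ge0 (mean s t (f_ n)); lra.
  move=> s t as_ st tb; exists (trunc n%:R (mean s t g)).
  apply: le_trans (gK s t as_ st tb); apply: mean_le => //.
  - exact/gauge_loc_int/loc_int_shift.
  - exact/gauge_loc_int/loc_int_shift.
  - by move=> x _; apply: gauge_le => //; exact: trunc_lip.
have cvg_f x : f_ n x @[n --> \oo] --> g x.
  apply: cvg_near_cst; have [N _ NP] := nbhs_infty_ger `|g x|.
  by exists N => // n Nn /=; rewrite /f_ trunc_id//; exact: NP.
have cvg_m s t : s < t -> mean s t (f_ n) @[n --> \oo] --> mean s t g.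
  by move=> st; exact: (mean_dominated_cvg st mf mg lg fg cvg_f).
(* The means of the truncations over [[a, b]] are bounded by [A] and their variances by [M^2], so
   their second moments are at most [A^2 + M^2]. *)
have lg2 : loc_int (fun x => g x ^+ 2).
  pose A := mean a b (fun x => `|g x|).
  have lng : loc_int (fun x => `|g x|).
    by apply: (loc_int_le _ lg) => [|x]; [exact: measurableT_comp|rewrite normr_id].
  have meanA n : mean a b (f_ n) ^+ 2 <= A ^+ 2.
    have A1 : mean a b (f_ n) <= A.
      by apply: mean_le => // x _; apply: le_trans (ler_norm _) (fg n x).
    have A2 : - A <= mean a b (f_ n).
      have <- : mean a b (fun x => - 1 * `|g x| + 0 * `|g x| + 0) = - A.
        by rewrite mean_lin3// /A; ring.
      apply: mean_le => //.
        by apply: loc_intD; [apply: loc_intD; exact: loc_intZ|exact: loc_int_cst].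
      move=> x _; have := fg n x; have := ler_norm (- f_ n x); rewrite normrN; lra.
    have A0 : 0 <= A by exact: mean_ge0.
    rewrite -(real_normK (num_real (mean a b (f_ n)))) ler_sqr ?nnegrE//.
    by rewrite ler_norml A2.
  have int2 : leb.-integrable `[a, b] (EFin \o (fun x => g x ^+ 2)).
    apply/integrableP; split.
      apply/measurable_EFinP/measurable_funTS; exact: (@measurable_funX _ _ R setT g 2).
    under eq_integral do rewrite /= ger0_norm ?sqr_ge0//.
    apply: (@le_lt_trans _ _ ((b - a) * (A ^+ 2 + M ^+ 2))%:E); last exact: ltry.
    apply: trunc_sqr_integral_bound => // n.
    have := fM n a b (lexx _) ab (lexx _); have := meanA n => mA mM.
    have {mA mM} : mean a b (fun x => f_ n x ^+ 2) <= A ^+ 2 + M ^+ 2 by lra.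
    rewrite /mean ler_pdivrMl ?subr_gt0// -lee_fin; apply: le_trans.
    rewrite /Rintegral fineK//; apply: integrable_fin_num => //;
      exact: loc_int_itv (lf2 n).
  have gE : (fun x => g x ^+ 2) = (fun x => g x ^+ 2) \_ `[a, b].
    apply/funext => x; rewrite patchE; case: ifPn => //;
      rewrite notin_setE /= in_itv /= => /g0 ->.
    by rewrite expr0n.
  by rewrite gE; apply: integrable_locally.
split => //; exists M => // u v au uv vb.
have c1 := cvg_m u v uv.
have c2 : mean u v (fun x => f_ n x ^+ 2) @[n --> \oo] --> mean u v (fun x => g x ^+ 2).
  apply: (mean_dominated_cvg uv mf2 _ lg2).
  - exact: (@measurable_funX _ _ R setT g 2).
  - move=> n x; rewrite !ger0_norm ?sqr_ge0// -(real_normK (num_real (f_ n x)))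
    -(real_normK (num_real (g x))).
    by rewrite ler_sqr ?nnegrE.
  - move=> x; apply: cvg_near_cst; have [N _ NP] := nbhs_infty_ger `|g x|.
    by exists N => // n Nn /=; rewrite /f_ trunc_id//; exact: NP.
have c3 : mean u v (fun x => f_ n x ^+ 2) - mean u v (f_ n) * mean u v (f_ n) @[n
  --> \oo] -->
    mean u v (fun x => g x ^+ 2) - mean u v g * mean u v g.
  by apply: cvgB => //; exact: cvgM.
have : mean u v (fun x => g x ^+ 2) - mean u v g * mean u v g <= M ^+ 2.
  apply: (@cvgr_to_le nat \oo _ R _ _ _ c3); apply: nearW => n.
  by have := fM n u v au uv vb; lra.
by lra.
Qed.

(** * The two norms as suprema of averages *)

Lemma eavg_represents (R : realType) (Q : set R) (f g u : R ->
  R) (p q : bool) (s t : R) :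
  represents Q f g -> measurable_fun setT u -> loc_int (u \o g) ->
  s < t -> [set` Interval (BSide p s) (BSide q t)] `<=` Q ->
  eavg [set` Interval (BSide p s) (BSide q t)] (u \o f) = (mean s t (u \o g))%:E.
Proof.
move=> [_ rep] mu_ lug st JQ; rewrite rep// /mean EFinM /Rintegral fineK//.
by apply: integrable_fin_num => //; exact: loc_int_itv.
Qed.

Lemma avg_represents (R : realType) (Q : set R) (f g : R -> R) (p q : bool) (s t : R) :
  represents Q f g -> s < t -> [set` Interval (BSide p s) (BSide q t)] `<=` Q ->
  avg [set` Interval (BSide p s) (BSide q t)] f = mean s t g.
Proof.
move=> rep st JQ; have [lg _] := rep.
by rewrite /avg (@eavg_represents R Q f g id).
Qed.

Lemma eavg_osc_represents (R : realType) (Q : set R) (h f g : R ->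
  R) (p q : bool) (s t : R) :
  gauge h -> represents Q f g -> s < t ->
  [set` Interval (BSide p s) (BSide q t)] `<=` Q ->
  let J := [set` Interval (BSide p s) (BSide q t)] in
  eavg J (fun x => h `|f x - avg J f|) = (mean s t (fun x => h `|g x - mean s t g|))%:E.
Proof.
move=> gh rep st JQ; have [lg _] := rep; rewrite /= (avg_represents rep st JQ).
set c := mean s t g.
apply: (@eavg_represents R Q f g (fun y => h `|y - c|)) => //.
  have mh : measurable_fun setT (fun x : R => h `|x|).
    by apply: continuous_measurable_fun; exact: gauge_continuous.
  apply: (measurableT_comp mh); exact: measurable_funB.
exact/gauge_loc_int/loc_int_shift.
Qed.

Lemma eavg_sqr_represents (R : realType) (Q : set R) (f g : R ->
  R) (p q : bool) (s t : R) :
  represents Q f g -> loc_int (fun x => g x ^+ 2) -> s < t ->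
  [set` Interval (BSide p s) (BSide q t)] `<=` Q ->
  let J := [set` Interval (BSide p s) (BSide q t)] in
  eavg J (fun x => `|f x - avg J f| ^+ 2) =
  (mean s t (fun x => g x ^+ 2) - mean s t g ^+ 2)%:E.
Proof.
move=> rep lg2 st JQ; have [lg _] := rep; rewrite /= (avg_represents rep st JQ).
set c := mean s t g.
have -> : mean s t (fun x => g x ^+ 2) - c ^+ 2 = mean s t (fun x => (g x - c) ^+ 2).
  by rewrite mean_sqr_shift// -/c; ring.
have -> : (fun x => `|f x - c| ^+ 2) = (fun y : R => (y - c) ^+ 2) \o f.
  by apply/funext => x /=; rewrite real_normK ?num_real.
apply: (@eavg_represents R Q f g (fun y => (y - c) ^+ 2)) => //.
  by apply: measurable_funX; apply: measurable_funB.
exact: loc_int_sqr_shift.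
Qed.

Lemma avg_sqr_represents (R : realType) (Q : set R) (f g : R ->
  R) (p q : bool) (s t : R) :
  represents Q f g -> loc_int (fun x => g x ^+ 2) -> s < t ->
  [set` Interval (BSide p s) (BSide q t)] `<=` Q ->
  avg [set` Interval (BSide p s) (BSide q t)] (fun x => f x ^+ 2) =
  mean s t (fun x => g x ^+ 2).
Proof.
move=> rep lg2 st JQ; rewrite /avg.
by rewrite (@eavg_represents R Q f g (fun y => y ^+ 2))//; exact: exprn_measurable.
Qed.

Section suprema.
Context {R : realType} (h f g : R -> R) (p q : bool) (a b : R).
Let Q : set R := [set` Interval (BSide p a) (BSide q b)].
Hypotheses (ab : a < b) (gh : gauge h) (rep : represents Q f g).
Let osc s t := mean s t (fun x => h `|g x - mean s t g|).

Lemma oscK_le (K : R) : (forall s t, a <= s -> s < t -> t <= b -> osc s t <= K) ->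
  (oscK h Q f <= K%:E)%E.
Proof.
move=> HK; apply: ge_ereal_sup => _ [J /= JQ <-].
have [p' [q' [s [t [as_ st tb JE]]]]] := subinterval_ends JQ.
have [_ JQ'] := JQ; rewrite JE in JQ' *.
by rewrite (eavg_osc_represents gh rep st JQ') lee_fin; exact: HK.
Qed.

Lemma osc_le_oscK (s t : R) : a <= s -> s < t -> t <= b ->
  ((osc s t)%:E <= oscK h Q f)%E.
Proof.
move=> as_ st tb; have JQ := subinterval_open p q as_ st tb.
have [_ JQ'] := JQ.
apply: ereal_sup_ubound; exists `]s, t[%classic => //.
by rewrite (eavg_osc_represents gh rep st JQ').
Qed.

Lemma oscK_ge0 : (0 <= oscK h Q f)%E.
Proof.
apply: le_trans (osc_le_oscK (lexx a) ab (lexx b)).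
have [lg _] := rep; rewrite lee_fin; apply: mean_ge0 => //.
  exact/gauge_loc_int/loc_int_shift.
by move=> x; exact/(gauge_ge0 gh)/normr_ge0.
Qed.

Hypothesis lg2 : loc_int (fun x => g x ^+ 2).

Lemma bmo_norm_le (E : R) : 0 <= E -> bmo_le g a b E -> (bmo_norm Q f <= E%:E)%E.
Proof.
move=> E0 gE; apply: ge_ereal_sup => _ [J /= JQ <-].
have [p' [q' [s [t [as_ st tb JE]]]]] := subinterval_ends JQ.
have [_ JQ'] := JQ; rewrite JE in JQ' *.
rewrite (eavg_sqr_represents rep lg2 st JQ') /= lee_fin.
rewrite -(ger0_norm E0) -sqrtr_sqr ler_wsqrtr//.
by have := gE s t as_ st tb; lra.
Qed.

Lemma bmo_norm_ge0 : (0 <= bmo_norm Q f)%E.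
Proof.
have JQ := subinterval_open p q (lexx a) ab (lexx b).
apply: le_trans (ereal_sup_ubound _) => /=; last by exists `]a, b[%classic.
exact: sqrte_ge0.
Qed.

Lemma bmo_le_bmo_norm : (bmo_norm Q f < +oo)%E -> bmo_le g a b (fine (bmo_norm Q f)).
Proof.
move=> fin s t as_ st tb; have JQ := subinterval_open p q as_ st tb.
have [_ JQ'] := JQ.
have fE : bmo_norm Q f \is a fin_num by rewrite ge0_fin_numE// bmo_norm_ge0.
pose F := fun x => `|f x - avg `]s, t[%classic f| ^+ 2.
have : (sqrte (eavg `]s, t[%classic F) <= bmo_norm Q f)%E.
  by apply: ereal_sup_ubound; exists `]s, t[%classic.
rewrite /F (eavg_sqr_represents rep lg2 st JQ') /= -[in leRHS](fineK fE) lee_fin.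
set v := _ - _; set E := fine _ => vE.
have E0 : 0 <= E by exact/fine_ge0/bmo_norm_ge0.
have v0 : 0 <= v.
  have [lg _] := rep; rewrite subr_ge0; exact: mean_sqr_ge.
have : v <= E ^+ 2 by rewrite -(sqr_sqrtr v0) ler_sqr ?nnegrE.
by rewrite /v; lra.
Qed.

End suprema.

(** For each [d > E], monotonicity first replaces [h (2 d)] by [h (2 E)]; then only the factor
    [r = d^2] has to tend to [E^2]. *)
Lemma osc_lower_sharp (R : realType) (h g : R -> R) (a b s t c E : R) :
  gauge h -> 0 < E -> a <= s -> s < t -> t <= b ->
  loc_int g -> loc_int (fun x => g x ^+ 2) -> bmo_le g a b E ->
  (mean s t (fun x => g x ^+ 2) - mean s t g ^+ 2) / (4 * E ^+ 2) * h (2 * E) <=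
  mean s t (fun x => h `|g x - c|).
Proof.
move=> gh E0 as_ st tb lg lg2 gE.
set v := _ - _; set H := mean s t _.
have v0 : 0 <= v by rewrite subr_ge0; exact: mean_sqr_ge.
have H0 : 0 <= H.
  apply: mean_ge0 => //; first exact/gauge_loc_int/loc_int_shift.
  by move=> x; exact/(gauge_ge0 gh)/normr_ge0.
have hE : 0 < h (2 * E) by apply: (gauge_gt0 gh); lra.
have E2 : 0 < E ^+ 2 by apply: exprn_gt0.
have key r : E ^+ 2 < r -> v * h (2 * E) <= 4 * r * H.
  move=> Er; pose d := Num.sqrt r; have r0 : 0 < r by lra.
  have d2 : d ^+ 2 = r by rewrite sqr_sqrtr// ltW.
  have Ed : E < d by rewrite -(gtr0_norm E0) -sqrtr_sqr ltr_sqrt.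
  have := @osc_lower R h g d E a b s t c gh E0 Ed as_ st tb lg lg2 gE.
  rewrite -/v -/H d2 mulrAC ler_pdivrMr; last lra.
  have hEd : h (2 * E) <= h (2 * d) by apply: (gauge_le gh); lra.
  have := ler_wpM2l v0 hEd; lra.
have -> : v / (4 * E ^+ 2) * h (2 * E) = v * h (2 * E) / (4 * E ^+ 2) by field; lra.
rewrite ler_pdivrMr; last lra.
apply/ler_addgt0Pr => k k0.
have HE : 0 < 4 * (H + 1) by lra.
have := key (E ^+ 2 + k / (4 * (H + 1))).
rewrite ltrDl divr_gt0// => /(_ isT) /le_trans; apply.
have : 4 * H * (k / (4 * (H + 1))) <= k.
  have -> : 4 * H * (k / (4 * (H + 1))) = k * (H / (H + 1)) by field; lra.
  by rewrite ger_pMr// ler_pdivrMr; lra.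
by lra.
Qed.

(** Jensen's inequality for [h] of a square root, by hand: the tangent at [E] and
    [2 E y <= y^2 + E^2] give [h y <= h E + m (y^2 - E^2) / (2 E)], whose last term has nonpositive
    average when the variance is at most [E^2]. *)
Lemma osc_upper (R : realType) (h g : R -> R) (a b s t E : R) :
  gauge h -> 0 < E -> a <= s -> s < t -> t <= b ->
  loc_int g -> loc_int (fun x => g x ^+ 2) -> bmo_le g a b E ->
  mean s t (fun x => h `|g x - mean s t g|) <= h E.
Proof.
move=> gh E0 as_ st tb lg lg2 gE; set c := mean s t g.
have [m m0 mh] := gauge_tangent gh E0.
have lc := loc_int_shift c lg; have lc2 := loc_int_sqr_shift c lg lg2.
pose B := m / (2 * E); have B0 : 0 <= B by apply: divr_ge0; lra.
have : mean s t (fun x => h `|g x - c|) <=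
    mean s t (fun x => 0 * (g x - c) + B * (g x - c) ^+ 2 + (h E - m * E / 2)).
  apply: mean_le => //; first exact: gauge_loc_int.
    by apply: loc_intD; [apply: loc_intD; exact: loc_intZ|exact: loc_int_cst].
  move=> x _; apply: le_trans (mh _ (normr_ge0 _)) _.
  rewrite -[(g x - c) ^+ 2]real_normK ?num_real//; set y := `|_|.
  rewrite -subr_ge0 (_ : _ - _ = B * (y - E) ^+ 2); last by rewrite /B; field; lra.
  by apply: mulr_ge0 => //; exact: sqr_ge0.
rewrite mean_lin3// mean_sqr_shift// -/c mul0r add0r => /le_trans; apply.
have := gE s t as_ st tb; rewrite -/c => v.
have : B * (mean s t (fun x => g x ^+ 2) - 2 * c * c + c ^+ 2) <= B * E ^+ 2.
  by apply: ler_wpM2l => //; lra.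
have -> : B * E ^+ 2 = m * E / 2 by rewrite /B; field; lra.
by lra.
Qed.

(** The supremum defining the norm need not be attained, hence the minimality of [E]: every variance
    is at most [r = 4 E^2 K / h (2 E)], so [E^2 <= r]. *)
Lemma gauge_bmo_le (R : realType) (h g : R -> R) (a b K E : R) :
  gauge h -> 0 < E -> loc_int g -> loc_int (fun x => g x ^+ 2) -> bmo_le g a b E ->
  (forall E', 0 <= E' -> bmo_le g a b E' -> E <= E') -> 0 <= K ->
  (forall s t, a <= s -> s < t -> t <= b ->
    mean s t (fun x => h `|g x - mean s t g|) <= K) ->
  h (2 * E) <= 4 * K.
Proof.
move=> gh E0 lg lg2 gE Emin K0 HK.
have hE : 0 < h (2 * E) by apply: (gauge_gt0 gh); lra.
have E2 : 0 < E ^+ 2 by apply: exprn_gt0.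
pose r := 4 * E ^+ 2 * K / h (2 * E).
have r0 : 0 <= r by apply: divr_ge0; [apply: mulr_ge0; lra|lra].
have : E <= Num.sqrt r.
  apply: Emin; first exact: sqrtr_ge0.
  move=> s t as_ st tb; rewrite sqr_sqrtr// addrC -lerBlDr.
  have := le_trans (osc_lower_sharp (mean s t g) gh E0 as_ st tb lg lg2 gE) (HK s t
    as_ st tb).
  set v := _ - _; rewrite mulrAC ler_pdivrMr; last lra.
  by rewrite /r ler_pdivlMr//; lra.
rewrite -(@ler_pXn2r _ 2)// ?nnegrE ?sqrtr_ge0//; last exact: ltW.
rewrite sqr_sqrtr// /r ler_pdivlMr// => Eh.
by rewrite -(ler_pM2l E2); lra.
Qed.

(** Norm zero makes the variance over all of [Q] vanish, and then [f] equals its mean almost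
    everywhere. *)
Lemma nonconstant_bmo_gt0 (R : realType) (f g : R -> R) (p q : bool) (a b E : R) :
  a < b -> let Q := [set` Interval (BSide p a) (BSide q b)] in
  integrable_on Q f -> nonconstant_on Q f -> represents Q f g ->
  loc_int (fun x => g x ^+ 2) -> bmo_le g a b E -> 0 <= E -> 0 < E.
Proof.
move=> ab Q fQ nc rep lg2 gE E0; rewrite lt_neqAle E0 andbT; apply/eqP => EE; apply: nc.
have [lg _] := rep.
exists (mean a b g).
have m0 : mean a b (fun x => g x ^+ 2) - mean a b g ^+ 2 = 0.
  have := gE a b (lexx _) ab (lexx _); have := mean_sqr_ge ab lg lg2.
  by rewrite -EE expr0n /=; lra.
have := eavg_sqr_represents rep lg2 ab (@subset_refl _ Q).
rewrite /= (avg_represents rep ab (@subset_refl _ Q)) m0 /eavg.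
rewrite completed_lebesgue_itv//.
have mQ : measurable (Q : set (lebesgueTypeR R)).
  by apply: borel_lebesgue_measurable; exact: measurable_itv.
have mf : measurable_fun (Q : set (lebesgueTypeR R)) f.
  by apply/measurable_EFinP; exact: (measurable_int _ fQ).
rewrite inver subr_eq0 gt_eqF// => /eqP;
  rewrite mule_eq0 eqe invr_eq0 subr_eq0 gt_eqF//= => /eqP I0.
pose c := mean a b g.
have mu_ : measurable_fun setT (fun y : R => (`|y - c| ^+ 2)%:E).
  by apply/measurable_EFinP; apply: measurable_funX; apply: measurableT_comp => //;
    exact: measurable_funB.
have mfc : measurable_fun (Q : set (lebesgueTypeR R)) (fun x => (`|f x - c| ^+ 2)%:E).
  exact: (measurableT_comp mu_ mf).
have : ae_eq clm Q (fun x => (`|f x - c| ^+ 2)%:E) (cst 0%E).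
  apply: (@ae_eq_integral_abs _ (lebesgueTypeR R) R clm Q mQ _ mfc).1.
  by rewrite -[RHS]I0; apply: eq_integral => x _; rewrite gee0_abs// lee_fin sqr_ge0.
apply: filterS => x /= fx Qx; have := fx Qx => -[] /eqP.
by rewrite sqrf_eq0 normr_eq0 subr_eq0 => /eqP.
Qed.

(** * A function for which equality holds *)

Lemma integrable_on_loc_int (R : realType) (p q : bool) (a b : R) (f : R -> R) :
  loc_int f -> integrable_on [set` Interval (BSide p a) (BSide q b)] f.
Proof.
move=> lf; set Q := [set` _].
have mQ : measurable (Q : set (measurableTypeR R)) by exact: measurable_itv.
have [mf _ _] := lf.
have mfQ : measurable_fun (Q : set (measurableTypeR R)) (EFin \o f).
  by apply/measurable_EFinP; exact: measurable_funTS.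
apply/integrableP; split; first exact: measurable_borel_comp.
rewrite integral_completed//; last exact: measurableT_comp.
have /integrableP[_] : leb.-integrable Q (EFin \o f).
  apply: integrableS (loc_int_itv a b lf) => //.
  exact: subset_itv_closure.
by [].
Qed.

Lemma eavg_ae_constant (R : realType) (p q : bool) (a b c : R) (f u : R -> R) :
  a < b -> let Q := [set` Interval (BSide p a) (BSide q b)] in
  measurable_fun setT f -> measurable_fun setT u ->
  {ae clm, forall x, Q x -> f x = c} -> eavg Q (u \o f) = (u c)%:E.
Proof.
move=> ab Q mf mu_ fc; rewrite /eavg.
have mQ : measurable (Q : set (measurableTypeR R)) by exact: measurable_itv.
have muf : measurable_fun setT (u \o f) by exact: measurableT_comp.
have muQ : clm Q = (b - a)%:E by exact: completed_lebesgue_itv.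
rewrite (@ae_eq_integral _ (lebesgueTypeR R) R clm Q (cst (u c)%:E))//.
- rewrite integral_cst; last exact: borel_lebesgue_measurable.
  rewrite [X in (_ * (_ * X))%E]muQ [X in (X^-1 * _)%E]muQ inver subr_eq0 gt_eqF//.
  by rewrite -!EFinM mulrCA mulVf ?mulr1// subr_eq0 gt_eqF.
- exact: borel_lebesgue_measurable.
- apply: measurable_borel_comp => //; apply/measurable_EFinP; exact: measurable_funTS.
- have [N [mN N0 NS]] := fc; exists N; split => // x /= /not_implyP[Qx ne].
  by apply: NS => /= fx; apply: ne; rewrite /= fx.
Qed.

Lemma mean_indic (R : realType) (A : set R) (s t l : R) : s < t ->
  measurable A -> leb (A `&` `[s, t]) = l%:E -> (t - s) * mean s t \1_A = l.
Proof.
move=> st mA Al; rewrite /mean mulVKf ?subr_eq0 ?gt_eqF// /Rintegral.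
by rewrite integral_indic// [X in fine X]Al.
Qed.

Lemma leb_itv (R : realType) (p q : bool) (x y : R) : x <= y ->
  leb [set` Interval (BSide p x) (BSide q y)] = (y - x)%:E.
Proof.
rewrite le_eqVlt => /predU1P[->|xy]; rewrite lebesgue_measure_itv /= lte_fin.
  by rewrite ltxx subrr.
by rewrite xy.
Qed.

Lemma mean_indic_ray_l (R : realType) (x s t : R) : s < t ->
  exists2 l, (t - s) * mean s t \1_`]-oo, x[ = l &
    [\/ x <= s /\ l = 0, [/\ s <= x, x <= t & l = x - s] | t <= x /\ l = t - s].
Proof.
move=> st; exists ((t - s) * mean s t \1_`]-oo, x[) => //.
have [xs|sx] := leP x s.
  constructor 1; split => //; apply: mean_indic => //.
  rewrite (_ : _ `&` _ = set0) ?measure0//; apply/seteqP; split => // y [].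
  by rewrite /= !in_itv /= => yx /andP[sy _]; lra.
have [xt|tx] := leP x t.
  constructor 2; split => //; first exact: ltW.
  apply: mean_indic => //; rewrite (_ : _ `&` _ = `[s, x[%classic);
    first exact: leb_itv (ltW sx).
  apply/seteqP; split => y; rewrite /= !in_itv /=.
    by move=> [yx /andP[-> _]].
  by move=> /andP[sy yx]; split => //; rewrite sy; lra.
constructor 3; split; first exact: ltW.
apply: mean_indic => //; rewrite (_ : _ `&` _ = `[s, t]%classic);
  first exact: leb_itv (ltW st).
apply/seteqP; split => y; rewrite /= !in_itv /=; first by case.
by move=> /andP[sy yt]; split; [lra|rewrite sy].
Qed.

Lemma mean_indic_ray_r (R : realType) (x s t : R) : s < t ->
  exists2 r, (t - s) * mean s t \1_`]x, +oo[ = r &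
    [\/ t <= x /\ r = 0, [/\ s <= x, x <= t & r = t - x] | x <= s /\ r = t - s].
Proof.
move=> st; exists ((t - s) * mean s t \1_`]x, +oo[) => //.
have [tx|xt] := leP t x.
  constructor 1; split => //; apply: mean_indic => //.
  rewrite (_ : _ `&` _ = set0) ?measure0//; apply/seteqP; split => // y [].
  by rewrite /= !in_itv /= andbT => yx /andP[_ sy]; lra.
have [sx|xs] := leP s x.
  constructor 2; split => //; first exact: ltW.
  apply: mean_indic => //; rewrite (_ : _ `&` _ = `]x, t]%classic);
    first exact: leb_itv (ltW xt).
  apply/seteqP; split => y; rewrite /= !in_itv /= andbT.
    by move=> [-> /andP[_ ->]].
  by move=> /andP[sy yx]; split => //; apply/andP; split; lra.
constructor 3; split; first exact: ltW.
apply: mean_indic => //; rewrite (_ : _ `&` _ = `[s, t]%classic);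
  first exact: leb_itv (ltW st).
apply/seteqP; split => y; rewrite /= !in_itv /= andbT; first by case.
by move=> /andP[sy yt]; split; [lra|rewrite sy].
Qed.

(* In case of equality f - <f>_J only takes the values 0 and +-2 ||f||; with the
   proportions 1/8, 3/4, 1/8 the norm is 1 and is attained on the whole of J. *)
Definition three_steps (R : realType) (a b x : R) : R :=
  - 2 * \1_`]-oo, a + (b - a) / 8[ x + 2 * \1_`]b - (b - a) / 8, +oo[ x + 0.

(** Both sides keep the shape [A f + B g + C] of [mean_lin3], which explains the summand 0. *)
Lemma three_steps_comp (R : realType) (u : R -> R) (a b x : R) : a < b -> u 0 = 0 ->
  u (three_steps a b x) = u (- 2) * \1_`]-oo, a + (b - a) / 8[ x +
    u 2 * \1_`]b - (b - a) / 8, +oo[ x + 0.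
Proof.
move=> ab u0; rewrite /three_steps !indicE.
have [xa|ax] := ltP x (a + (b - a) / 8).
  rewrite mem_set ?memNset /= ?in_itv //= ?mulr1 ?mulr0 ?addr0//.
  by move=> /andP[]; lra.
have -> : x \in `]-oo, a + (b - a) / 8[%classic = false.
  by apply/negbTE; rewrite notin_setE /= in_itv /=; lra.
have [bx|xb] := ltP (b - (b - a) / 8) x.
  by rewrite mem_set /= ?in_itv //= ?andbT// !mulr0 !mulr1 !add0r !addr0.
have -> : x \in `]b - (b - a) / 8, +oo[%classic = false.
  by apply/negbTE; rewrite notin_setE /= in_itv /= andbT; lra.
by rewrite !mulr0 !addr0.
Qed.

Lemma three_steps_loc_int (R : realType) (u : R -> R) (a b : R) : a < b -> u 0 = 0 ->
  loc_int (fun x => u (three_steps a b x)).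
Proof.
move=> ab u0.
have -> : (fun x => u (three_steps a b x)) = (fun x =>
  u (- 2) * \1_`]-oo, a + (b - a) / 8[ x +
    u 2 * \1_`]b - (b - a) / 8, +oo[ x + 0).
  by apply/funext => x; exact: three_steps_comp.
apply: loc_intD; last exact: loc_int_cst.
by apply: loc_intD; apply: loc_intZ; apply: locally_integrable_indic => //;
  exact: openT.
Qed.

Lemma three_steps_mean (R : realType) (u : R -> R) (a b s t : R) : a < b ->
  s < t -> u 0 = 0 ->
  mean s t (fun x => u (three_steps a b x)) =
  u (- 2) * mean s t \1_`]-oo, a + (b - a) / 8[ + u 2 * mean s t \1_`]b - (b - a) /
    8, +oo[.
Proof.
move=> ab st u0; rewrite -[RHS]addr0 -mean_lin3//.
- by congr mean; apply/funext => x; exact: three_steps_comp.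
- by apply: locally_integrable_indic => //; exact: openT.
- by apply: locally_integrable_indic => //; exact: openT.
Qed.

(** A segment that misses one outer step sees only 0 and one of the values [+-2], in proportion [p]
    say, and has variance [16 p (1 - p) / 4 <= 1]. A segment that meets both contains the middle
    step, so the outer steps fill at most a quarter of it and already the second moment is at most
    1. *)
Lemma three_steps_bmo (R : realType) (a b : R) : a < b ->
  bmo_le (three_steps a b) a b 1.
Proof.
move=> ab s t as_ st tb.
rewrite (@three_steps_mean R (fun y => y ^+ 2))// ?expr0n//.
rewrite (@three_steps_mean R id)//.
have [l lE lP] := mean_indic_ray_l (a + (b - a) / 8) st.
have [r rE rP] := mean_indic_ray_r (b - (b - a) / 8) st.
move: lE rE; set m1 := mean _ _ _; set m2 := mean _ _ _ => lE rE.
have L0 : 0 < t - s by lra.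
have L2 : 0 < (t - s) ^+ 2 by apply: exprn_gt0.
rewrite -(ler_pM2l L2).
have -> : (t - s) ^+ 2 * ((- 2) ^+ 2 * m1 + 2 ^+ 2 * m2) = 4 * (l + r) * (t - s).
  by rewrite -lE -rE; ring.
have -> : (t - s) ^+ 2 * ((- 2 * m1 + 2 * m2) ^+ 2 + 1 ^+ 2) = 4 * (r - l) ^+ 2 +
  (t - s) ^+ 2.
  by rewrite -lE -rE; ring.
have sqr_case (y : R) : 4 * y * (t - s) <= 4 * y ^+ 2 + (t - s) ^+ 2.
  by have := sqr_ge0 (2 * y - (t - s)); lra.
case: lP => [[_ ->]|[sl lt le]|[tl le]].
- by rewrite add0r subr0; exact: sqr_case.
- case: rP => [[_ ->]|[sr rt re]|[rs re]]; last by lra.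
    by rewrite addr0 sub0r sqrrN; exact: sqr_case.
  have : 4 * (l + r) * (t - s) <= (t - s) * (t - s) by rewrite ler_pM2r//; lra.
  by have := sqr_ge0 (r - l); lra.
- case: rP => [[_ ->]|[sr rt re]|[rs re]]; try lra.
  by rewrite addr0 sub0r sqrrN; exact: sqr_case.
Qed.

Lemma three_steps_total (R : realType) (u : R -> R) (a b : R) : a < b -> u 0 = 0 ->
  mean a b (fun x => u (three_steps a b x)) = (u (- 2) + u 2) / 8.
Proof.
move=> ab u0; rewrite three_steps_mean//.
have [l lE lP] := mean_indic_ray_l (a + (b - a) / 8) ab.
have [r rE rP] := mean_indic_ray_r (b - (b - a) / 8) ab.
have L0 : b - a != 0 by lra.
have {}lP : l = (b - a) / 8 by case: lP => [[? ?]|[? ? ?]|[? ?]]; lra.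
have {}rP : r = (b - a) / 8 by case: rP => [[? ?]|[? ? ?]|[? ?]]; lra.
have -> : mean a b \1_`]-oo, a + (b - a) / 8[ = 8^-1.
  by apply: (mulfI L0); rewrite lE lP.
have -> : mean a b \1_`]b - (b - a) / 8, +oo[ = 8^-1.
  by apply: (mulfI L0); rewrite rE rP.
by ring.
Qed.

(** The mean is 0 and the second moment is 1, which no constant allows. *)
Lemma three_steps_nonconstant (R : realType) (p q : bool) (a b : R) : a < b ->
  nonconstant_on [set` Interval (BSide p a) (BSide q b)] (three_steps a b).
Proof.
move=> ab [c fc].
have lf : loc_int (three_steps a b) by apply: (@three_steps_loc_int R id).
have lf2 : loc_int (fun x => three_steps a b x ^+ 2).
  by apply: (@three_steps_loc_int R (fun y => y ^+ 2)) => //; rewrite expr0n.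
have [mf _ _] := lf.
have rep := @represents_self R [set` Interval (BSide p a) (BSide q b)] _ lf.
have := @eavg_ae_constant R p q a b c _ id ab mf (@measurable_id _ _ _) fc.
rewrite (@eavg_represents R _ _ _ id p q a b rep)//.
rewrite [mean _ _ _](@three_steps_total R id)// => -[c0].
have mX : measurable_fun setT (fun y : R => y ^+ 2) by exact: exprn_measurable.
have := @eavg_ae_constant R p q a b c _ (fun y => y ^+ 2) ab mf mX fc.
rewrite (@eavg_represents R _ _ _ (fun y => y ^+ 2) p q a b rep)//.
rewrite [mean _ _ _](@three_steps_total R (fun y => y ^+ 2))// ?expr0n// => -[].
by rewrite -c0 /=; lra.
Qed.

(** * The inverse of [h] and the conclusion *)

Lemma inv_ge0_gauge (R : realType) (h : R -> R) (y : R) : gauge h -> 0 <= y ->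
  0 <= inv_ge0 h y /\ h (inv_ge0 h y) = y.
Proof.
move=> gh y0; have [t t0 hty] := gauge_surj gh y0.
have hinj : set_inj `[0, +oo[%classic h.
  by move=> x z; rewrite !inE /= !in_itv /= !andbT => x0 z0; exact: gauge_inj.
rewrite /inv_ge0 -hty pinvKV//; last by rewrite inE /= in_itv /= t0.
Qed.

Lemma osc_represented (R : realType) (h f : R -> R) (p q : bool) (a b : R) :
  gauge h -> a < b -> let Q := [set` Interval (BSide p a) (BSide q b)] in
  nonconstant_on Q f -> integrable_on Q f -> (oscK h Q f < +oo)%E ->
  exists g, [/\ represents Q f g, loc_int (fun x => g x ^+ 2),
    (bmo_norm Q f < +oo)%E, 0 < fine (bmo_norm Q f) &
    bmo_le g a b (fine (bmo_norm Q f))].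
Proof.
move=> gh ab Q nc fQ fK; have Qb : bounded_itv Q by exists p, q, a, b.
have [g rep g0] := represented Qb fQ; have [lg _] := rep.
have K0 : (0 <= oscK h Q f)%E by exact: oscK_ge0 rep.
have Kfin : oscK h Q f \is a fin_num by rewrite ge0_fin_numE.
have [|x nx|s t as_ st tb|lg2 [M M0 gM]] :=
  @osc_bmo R h g a b (fine (oscK h Q f)) gh ab _ lg.
- exact: fine_ge0.
- by apply: g0 => /subset_itv_closure; rewrite /= in_itv.
- by rewrite -lee_fin fineK//; exact: osc_le_oscK.
have E0 := bmo_norm_ge0 f p q ab.
have Elt : (bmo_norm Q f < +oo)%E.
  by apply: le_lt_trans (bmo_norm_le rep lg2 (ltW M0) gM) _; exact: ltry.
have gE := bmo_le_bmo_norm ab rep lg2 Elt.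
exists g; split => //.
exact: (nonconstant_bmo_gt0 ab fQ nc rep lg2 gE (fine_ge0 E0)).
Qed.

Theorem theorem1p4 (R : realType) (h : R -> R)
  (h_cont : {within `[0, +oo[, continuous h})
  (h_diff : forall t : R, 0 < t ->
    [/\ derivable h t 1, derivable h^`(1) t 1 & derivable h^`(2) t 1])
  (h_0 : h 0 = 0)
  (h_infty : h t @[t --> +oo] --> +oo)
  (h_d1 : forall t : R, 0 < t -> 0 < h^`(1) t)
  (h_d2 : forall t : R, 0 < t -> h^`(2) t < 0)
  (h_d3 : forall t : R, 0 < t -> 0 < h^`(3) t)
  (Q : set R) (Q_itv : bounded_itv Q) :
  [/\ (forall phi : R -> R,
        nonconstant_on Q phi -> integrable_on Q phi ->
        (oscK h Q phi < +oo)%E ->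
        BMO Q phi /\
        forall J : set R, subinterval J Q ->
          (avg J (fun x => phi x ^+ 2) - avg J phi ^+ 2)
            / (4 * fine (bmo_norm Q phi) ^+ 2)
            * h (2 * fine (bmo_norm Q phi))
          <= avg J (fun x => h `|phi x - avg J phi|)),
      (exists phi : R -> R,
        [/\ nonconstant_on Q phi, integrable_on Q phi,
            (oscK h Q phi < +oo)%E &
            exists J : set R,
              [/\ subinterval J Q, nonconstant_on J phi &
                (avg J (fun x => phi x ^+ 2) - avg J phi ^+ 2)
                  / (4 * fine (bmo_norm Q phi) ^+ 2)
                  * h (2 * fine (bmo_norm Q phi))
                = avg J (fun x => h `|phi x - avg J phi|)]]) &
      (forall phi : R -> R,
        nonconstant_on Q phi -> integrable_on Q phi ->
        (oscK h Q phi < +oo)%E ->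
        inv_ge0 h (fine (oscK h Q phi)) <= fine (bmo_norm Q phi)
        /\ fine (bmo_norm Q phi)
           <= 2^-1 * inv_ge0 h (4 * fine (oscK h Q phi)))].
Proof.
have gh := gauge_of_derivatives h_cont h_diff h_0 h_infty h_d1 h_d2 h_d3.
have [p [q [a [b [ab QE]]]]] := Q_itv; rewrite QE; split.
- move=> f nc fQ fK; have [g [rep lg2 Elt E0 gE]] := osc_represented gh ab nc fQ fK.
  have [lg _] := rep; split => // J JQ.
  have [p' [q' [s [t [as_ st tb JE]]]]] := subinterval_ends JQ.
  have [_ JQ'] := JQ; rewrite JE in JQ' *.
  rewrite (avg_sqr_represents rep lg2 st JQ') [avg _ (fun x => h _)]/avg.
  rewrite (eavg_osc_represents gh rep st JQ') (avg_represents rep st JQ') /=.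
  exact: (osc_lower_sharp _ gh E0 as_ st tb lg lg2 gE).
(* With norm 1, mean 0 and variance 1 on [Q], both sides equal [h 2 / 4] for [J = Q]. *)
- pose f := three_steps a b; exists f.
  have lf : loc_int f by apply: (@three_steps_loc_int R id).
  have lf2 : loc_int (fun x => f x ^+ 2).
    by apply: (@three_steps_loc_int R (fun y => y ^+ 2)) => //; rewrite expr0n.
  have rep := @represents_self R [set` Interval (BSide p a) (BSide q b)] f lf.
  have nc := @three_steps_nonconstant R p q a b ab.
  have f1 := @three_steps_bmo R a b ab.
  have m1 : mean a b f = 0 by rewrite (@three_steps_total R id)//=; ring.
  have m2 : mean a b (fun x => f x ^+ 2) = 1.
    by rewrite (@three_steps_total R (fun y => y ^+ 2)) ?expr0n//=; field.
  have mh : mean a b (fun x => h `|f x - 0|) = h 2 / 4.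
    rewrite (@three_steps_total R (fun y => h `|y - 0|)) ?subr0 ?normr0//.
    by rewrite normrN ger0_norm//; field.
  have Ele := bmo_norm_le rep lf2 ler01 f1.
  have Elt : (bmo_norm [set` Interval (BSide p a) (BSide q b)] f < +oo)%E.
    by apply: le_lt_trans Ele _; exact: ltry.
  have E0 := bmo_norm_ge0 f p q ab.
  (* At most 1 by [three_steps_bmo], at least 1 because the variance over the whole interval is
     1. *)
  have E1 : fine (bmo_norm [set` Interval (BSide p a) (BSide q b)] f) = 1.
    set E := fine _.
    have EleR : E <= 1 by rewrite -lee_fin fineK// ge0_fin_numE.
    have := bmo_le_bmo_norm ab rep lf2 Elt (lexx _) ab (lexx _).
    rewrite m1 m2 -/E expr0n /= add0r => E2.
    have := fine_ge0 E0; rewrite -/E => E00.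
    by apply/eqP; rewrite eq_le EleR -(@ler_pXn2r _ 2)// ?nnegrE ?expr1n//;
      exact: ler01.
  split => //; first exact: integrable_on_loc_int.
    apply: (@le_lt_trans _ _ (h 1)%:E); last exact: ltry.
    apply: (oscK_le gh rep) => s t as_ st tb.
    exact: (osc_upper gh ltr01 as_ st tb lf lf2 f1).
  exists [set` Interval (BSide p a) (BSide q b)]; split => //.
    by split => //; exists p, q, a, b.
  have QQ := @subset_refl _ [set` Interval (BSide p a) (BSide q b)].
  rewrite (avg_sqr_represents rep lf2 ab QQ) [avg _ (fun x => h _)]/avg.
  rewrite (eavg_osc_represents gh rep ab QQ) (avg_represents rep ab QQ) /=.
  by rewrite E1 m1 m2 mh expr0n expr1n mulr1 subr0 mulr1 mul1r mulrC.
- move=> f nc fQ fK; have [g [rep lg2 Elt E0 gE]] := osc_represented gh ab nc fQ fK.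
  have [lg _] := rep; set Q' := [set` _] in fK Elt E0 gE *.
  have osc0 : (0 <= oscK h Q' f)%E by exact: oscK_ge0 rep.
  have Kfin : oscK h Q' f \is a fin_num by rewrite ge0_fin_numE.
  have K0 := fine_ge0 osc0.
  have [i0 iE] := inv_ge0_gauge gh K0.
  have [|j0 jE] := @inv_ge0_gauge R h (4 * fine (oscK h Q' f)) gh;
    first exact: mulr_ge0.
  set K := fine (oscK h Q' f) in K0 i0 iE j0 jE *; set E := fine _ in E0 gE *.
  split.
    rewrite leNgt; apply/negP => Ei.
    have := gauge_lt gh (ltW E0) Ei; rewrite iE ltNge => /negP; apply.
    rewrite -lee_fin fineK//; apply: (oscK_le gh rep) => s t as_ st tb.
    exact: (osc_upper gh E0 as_ st tb lg lg2 gE).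
  rewrite leNgt; apply/negP => jE'.
  have jE2 : inv_ge0 h (4 * K) < 2 * E by lra.
  have := gauge_lt gh j0 jE2; rewrite jE ltNge => /negP; apply.
  apply: (gauge_bmo_le gh E0 lg lg2 gE) => //.
    move=> E' E'0 gE'; rewrite -lee_fin fineK;
      last by rewrite ge0_fin_numE// bmo_norm_ge0.
    exact: (bmo_norm_le rep lg2 E'0 gE').
  move=> s t as_ st tb; rewrite -lee_fin fineK//; exact: osc_le_oscK.
Qed.
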